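(* Suppose $\beta$ lies in the high temperature phase. Then the mixing time $\tau_{mix}(n)$ of the Glauber dynamics for the exponential random graph measure $p_n$ on $\mathcal G_n$ satisfies $\tau_{mix}(n)=\Theta(n^2\log n)$; that is, there are constants $0<c<C$ (depending on $\beta$ and $G_1,\dots,G_s$ but not on $n$) such that $c\,n^2\log n\le \tau_{mix}(n)\le C\,n^2\log n$ for all sufficiently large $n$.
   Context: Fix an integer $s\ge 1$, and graphs $G_1,\dots,G_s$, where $G_i$ has vertex set $V_i=\{1,\dots,|V_i|\}$ and edge set $E_i$; $G_1$ is the graph with vertex set $\{1,2\}$ and the single edge $\{1,2\}$. Fix $\beta=(\beta_1,\dots,\beta_s)$ with $\beta_1\in\mathbb R$ and $\beta_i>0$ for $i\ge 2$. Let $\mathcal G_n$ be the set of simple graphs on vertex set $[n]=\{1,\dots,n\}$, identified with $\{0,1\}^{\binom{[n]}{2}}$ (a graph $X$ is the set of its edges). For a fixed graph $G=(V,E)$ with $V=\{1,\dots,m\}$ and $X\in\mathcal G_n$, let $N_G(X)$ be the number of injective maps $\sigma:V\to[n]$ such that $\{\sigma(i),\sigma(j)\}\in X$ for every $\{i,j\}\in E$. The Gibbs measure is $p_n(X)=Z_n^{-1}\exp(H(X))$ with $H(X)=\sum_{i=1}^s\beta_i N_{G_i}(X)/n^{|V_i|-2}$ and $Z_n$ the normalizing constant. For $X\in\mathcal G_n$ and a pair $e\in\binom{[n]}{2}$, $X_{e+}=X\cup\{e\}$, $X_{e-}=X\setminus\{e\}$, $\partial_eH(X)=H(X_{e+})-H(X_{e-})$.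 The Glauber dynamics is the Markov chain on $\mathcal G_n$ which, from state $X$, picks $e$ uniformly at random among the $\binom n2$ pairs and moves to $X_{e+}$ with probability $e^{\partial_eH(X)}/(1+e^{\partial_eH(X)})$ and to $X_{e-}$ otherwise; its stationary distribution is $p_n$. The mixing time is the least number of steps $t$ such that, from every starting state, the law at time $t$ is within total variation distance $e^{-1}$ of the stationary distribution. Define $\Psi(p)=\sum_{i=1}^s 2\beta_i|E_i|p^{|E_i|-1}$ and $\varphi(p)=e^{\Psi(p)}/(1+e^{\Psi(p)})$ for $p\in[0,1]$. A fixed point is $p\in[0,1]$ with $\varphi(p)=p$. $\beta$ is in the high temperature phase if $\varphi$ has a unique fixed point $p^*$ in $[0,1]$ and $\varphi'(p^* )<1$. *)

(* Defs.v *)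
From mathcomp Require Import all_boot.
From Stdlib Require Import Reals.
Set Implicit Arguments.
Unset Strict Implicit.
Unset Printing Implicit Defensive.

Definition sumR (T : finType) (f : T -> R) : R :=
  foldr (fun x acc => Rplus (f x) acc) R0 (enum T).

(* Unordered pairs {u,v} of distinct vertices of [n] = 'I_n, encoded as (u,v)
   with u < v. *)
Definition pairT (n : nat) : finType := {p : 'I_n * 'I_n | (p.1 < p.2)%N}.

Definition graph (n : nat) : finType := {set pairT n}.

Definition adj (n : nat) (X : graph n) (u v : 'I_n) : bool :=
  [exists e in X, (((sval e).1 == u) && ((sval e).2 == v))
                  || (((sval e).1 == v) && ((sval e).2 == u))].

Definition Ncount (n m : nat) (EG : {set pairT m}) (X : graph n) : nat :=
  #|[pred sigma : {ffun 'I_m -> 'I_n} | injectiveb sigma &&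
      [forall e in EG, adj X (sigma (sval e).1) (sigma (sval e).2)]]|.

Section Model.
(* s graphs G_i (i : 'I_s), G_i has vertex set 'I_(m i) and edge set E i;
   beta i are the parameters. *)
Variables (s : nat) (m : 'I_s -> nat) (E : forall i : 'I_s, {set pairT (m i)})
          (beta : 'I_s -> R).

Definition Ham (n : nat) (X : graph n) : R :=
  sumR (fun i : 'I_s => (beta i * INR (Ncount (E i) X) / INR n ^ (m i - 2))%R).

Definition gibbs (n : nat) (X : graph n) : R :=
  (exp (Ham X) / sumR (fun Y : graph n => exp (Ham Y)))%R.

Definition dH (n : nat) (X : graph n) (e : pairT n) : R :=
  (Ham (e |: X) - Ham (X :\ e))%R.

Definition glauber (n : nat) (X Y : graph n) : R :=
  sumR (fun e : pairT n =>
    (/ INR 'C(n, 2) *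
     ((if Y == e |: X then exp (dH X e) / (1 + exp (dH X e)) else 0)
      + (if Y == X :\ e then 1 - exp (dH X e) / (1 + exp (dH X e)) else 0)))%R).

Fixpoint law (n : nat) (t : nat) (x0 : graph n) (Y : graph n) : R :=
  match t with
  | O => if Y == x0 then 1%R else 0%R
  | S t' => sumR (fun X : graph n => (law t' x0 X * glauber X Y)%R)
  end.

Definition tv_dist (n t : nat) (x0 : graph n) : R :=
  (/ 2 * sumR (fun Y : graph n => Rabs (law t x0 Y - gibbs Y)))%R.

Definition is_mixing_time (n t : nat) : Prop :=
  (forall x0 : graph n, (tv_dist t x0 <= exp (-1))%R) /\
  (forall t', (t' < t)%N -> exists x0 : graph n, (exp (-1) < tv_dist t' x0)%R).

Definition Psi (p : R) : R :=
  sumR (fun i : 'I_s => (2 * beta i * INR #|E i| * p ^ (#|E i| - 1))%R).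

Definition phi (p : R) : R := (exp (Psi p) / (1 + exp (Psi p)))%R.

Definition high_temperature : Prop :=
  exists pstar : R,
    ((0 <= pstar <= 1)%R /\ phi pstar = pstar) /\
    (forall q : R, (0 <= q <= 1)%R -> phi q = q -> q = pstar) /\
    (exists d : R, derivable_pt_lim phi pstar d /\ (d < 1)%R).

End Model.

(* Main.v *)
(* No coupling is constructed: everything is read off the action of the chain
   on functions of the graph, and it preserves increasing functions because
   the interactions beyond single edges are ferromagnetic. Let S_t be the
   difference of the expected numbers of edges at time t when starting from the
   complete and from the empty graph, and N the number of pairs.

   Upper bound. Since 2|X| + f is increasing as soon as |f| <= 1, the distance
   to equilibrium is at most 2 S_t. On graphs in which all normalised subgraph
   counts through every pair are close to their values at density pstar, one step
   contracts by 1 - (1 - phi'(pstar))/N up to a small error. Such graphs form an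
   order-convex set, outside of which the relevant function can be modified
   into an increasing one, so S_t contracts as well, up to the probability of
   leaving the set. That probability is controlled by a bootstrap: if the chain
   from the complete graph is dominated by Bernoulli(q), then by the bounded
   difference inequality its update probabilities are typically below any
   q' > phi(q), so that O(n^2 log n) steps later it is dominated by
   Bernoulli(q'); finitely many rounds lead from q = 1 to any q > pstar. The empty
   graph is treated symmetrically, starting from q = 0.

   Lower bound. S_t >= N (1 - 1/N)^t, while the number of edges at time t has
   variance at most t (1 + C/N)^(2t); for t <= c n^2 log n with c small,
   Chebyshev's inequality separates the two extreme starting states. *)

From Stdlib Require Import ZArith Lra FunctionalExtensionality Classical.
From HB Require Import structures.
From mathcomp Require Import all_boot perm.
From Stdlib Require Import Reals.
Require Import Defs.

Set Implicit Arguments.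
Unset Strict Implicit.
Unset Printing Implicit Defensive.

(** Two obstacles shape the argument. Contraction holds only near density pstar, while the complete
    and the empty graph are far from it, so the chain must first be driven there. Uniqueness of the
    fixed point keeps q - phi q bounded away from 0 on [p, 1] for every p > pstar, and phi q - q on
    [0, p] for p < pstar; this bounds the number of rounds. Moreover, each round compares order n^2
    log n steps, so the probability of a bad event is summed over that many times. The cost is a
    fixed power of n per round, which is affordable because domination is carried with error n^-K
    for every K. The concentration bound is exponential in n: a rooted count has total influence
    O(1) and single influences O(1/n), hence its squared influences add up to O(1/n), and a union
    over order n^2 roots is harmless. A sign [c] treats the two extreme starts together: c = 1 for
    the complete graph, c = -1 for the empty one. *)

Fact RplusA : associative Rplus. Proof. by move=> x y z; rewrite Rplus_assoc. Qed.
HB.instance Definition _ := Monoid.isComLaw.Build R R0 Rplus RplusA Rplus_comm Rplus_0_l.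
HB.instance Definition _ := Monoid.isMulLaw.Build R R0 Rmult Rmult_0_l Rmult_0_r.
HB.instance Definition _ :=
  Monoid.isAddLaw.Build R Rmult Rplus Rmult_plus_distr_r Rmult_plus_distr_l.

Reserved Notation "\rsum_ ( i : t | P ) F"
  (at level 41, F at level 41, i at level 50, format "'[' \rsum_ ( i  :  t  |  P ) '/  '  F ']'").
Reserved Notation "\rsum_ ( i : t ) F"
  (at level 41, F at level 41, i at level 50, format "'[' \rsum_ ( i  :  t ) '/  '  F ']'").
Reserved Notation "\rsum_ ( i 'in' A ) F"
  (at level 41, F at level 41, i, A at level 50, format "'[' \rsum_ ( i  'in'  A ) '/  '  F ']'").
Notation "\rsum_ ( i : t | P ) F" := (\big[Rplus/R0]_(i : t | P%B) F%R) : R_scope.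
Notation "\rsum_ ( i : t ) F" := (\big[Rplus/R0]_(i : t) F%R) : R_scope.
Notation "\rsum_ ( i 'in' A ) F" := (\big[Rplus/R0]_(i in A) F%R) : R_scope.

Local Delimit Scope nat_scope with N.
Local Open Scope R_scope.

Definition ind (b : bool) : R := if b then 1 else 0.

Lemma ind_bound b : 0 <= ind b <= 1.
Proof. by case: b => /=; lra. Qed.

(** * Finite sums of reals *)

Section Sums.
Variable I : finType.
Implicit Types (P : pred I) (F G : I -> R).

Lemma sumRE F : sumR F = \rsum_(i : I) F i.
Proof. by rewrite /sumR -big_enum /= unlock. Qed.

Lemma rsum_le P F G : (forall i, P i -> F i <= G i) ->
  \rsum_(i : I | P i) F i <= \rsum_(i : I | P i) G i.
Proof.
move=> le_FG; elim/big_ind2: _ => //; first exact: Rle_refl.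
by move=> *; apply: Rplus_le_compat.
Qed.

Lemma rsum_ge0 P F : (forall i, P i -> 0 <= F i) -> 0 <= \rsum_(i : I | P i) F i.
Proof.
move=> F_ge0; elim/big_ind: _ => //; first exact: Rle_refl.
by move=> *; apply: Rplus_le_le_0_compat.
Qed.

Lemma rsum_const P (x : R) : \rsum_(i : I | P i) x = INR #|[pred i | P i]| * x.
Proof.
rewrite big_const; elim: #|_| => [|k IHk]; first by rewrite /=; lra.
by rewrite iterS IHk S_INR; lra.
Qed.

Lemma rsum_constT (x : R) : \rsum_(i : I) x = INR #|I| * x.
Proof. by rewrite rsum_const; congr (INR _ * _); apply: eq_card. Qed.

Lemma rsum_const_mem (A : {pred I}) (x : R) : \rsum_(i in A) x = INR #|A| * x.
Proof. by rewrite rsum_const; congr (INR _ * _); apply: eq_card. Qed.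

Lemma rsum_distrr P F (x : R) : x * (\rsum_(i : I | P i) F i) = \rsum_(i : I | P i) (x * F i).
Proof. exact: big_distrr. Qed.

Lemma rsum_opp P F : \rsum_(i : I | P i) - F i = - \rsum_(i : I | P i) F i.
Proof.
rewrite (eq_bigr (fun i => -1 * F i)) => [|i _]; last by lra.
by rewrite -rsum_distrr; lra.
Qed.

Lemma rsum_sub P F G :
  \rsum_(i : I | P i) (F i - G i) = \rsum_(i : I | P i) F i - \rsum_(i : I | P i) G i.
Proof. by rewrite /Rminus -rsum_opp -big_split. Qed.

Lemma rsum_abs P F : Rabs (\rsum_(i : I | P i) F i) <= \rsum_(i : I | P i) Rabs (F i).
Proof.
elim/big_ind2: _ => [|x1 x2 y1 y2 h1 h2|i _].
- by rewrite Rabs_R0; lra.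
- by apply: Rle_trans (Rabs_triang _ _) _; lra.
- exact: Rle_refl.
Qed.

Lemma rsum_ind P F : \rsum_(i : I | P i) F i = \rsum_(i : I) (ind (P i) * F i).
Proof. by rewrite big_mkcond; apply: eq_bigr => i _; rewrite /ind; case: (P i); lra. Qed.

Lemma rsum_andb P (Q : pred I) F :
  \rsum_(i : I | P i && Q i) F i = \rsum_(i : I | P i) (ind (Q i) * F i).
Proof.
rewrite rsum_ind [RHS]rsum_ind; apply: eq_bigr => i _.
by case: (P i); case: (Q i) => /=; ring.
Qed.

Lemma card_rsum P (Q : pred I) :
  INR #|[pred i | P i && Q i]| = \rsum_(i : I | P i) ind (Q i).
Proof.
rewrite -[LHS]Rmult_1_r -rsum_const rsum_andb.
by apply: eq_bigr => i _; rewrite Rmult_1_r.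
Qed.

Lemma rsum_eqop (j : I) F : \rsum_(i : I) (ind (i == j) * F i) = F j.
Proof. by rewrite -rsum_ind big_pred1_eq. Qed.

Lemma rsum_term_le P F j : P j -> (forall i, P i -> 0 <= F i) -> F j <= \rsum_(i : I | P i) F i.
Proof.
move=> Pj F_ge0; rewrite (bigD1 j) //=.
have: 0 <= \rsum_(i : I | P i && (i != j)) F i by apply: rsum_ge0 => i /andP[/F_ge0].
by lra.
Qed.

End Sums.

(** * Monotone single-site dynamics *)

Section Functions.
Variable T : finType.
Notation state := {set T}.
Implicit Types (X Y : state) (f h : state -> R) (e d : T) (r : state -> R).

(** Expected value of [f] after a heat-bath update at [e]. Letting [r] be any function of the state
    covers the Glauber rates and constant rates at once. *)
Definition upd r e f X : R := r X * f (e |: X) + (1 - r X) * f (X :\ e).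

Definition inc f := forall X Y, X \subset Y -> f X <= f Y.
Definition bounded01 f := forall X, 0 <= f X <= 1.
Definition dif e f X : R := f (e |: X) - f (X :\ e).
Definition lip f (L : R) := forall e X, Rabs (dif e f X) <= L.
Definition sizeR X : R := INR #|X|.

Lemma inc_step f : (forall e X, f (X :\ e) <= f (e |: X)) -> inc f.
Proof.
move=> step X Y; move def_k: #|Y| => k; elim: k Y def_k => [|k IHk] Y Yk sXY.
  by move/eqP: Yk; rewrite cards_eq0 => /eqP Y0; move: sXY; rewrite Y0 subset0 => /eqP ->; lra.
have [sYX|] := boolP (Y \subset X).
  by have -> : X = Y; [apply/eqP; rewrite eqEsubset sXY | lra].
case/subsetPn=> e Ye Xe; apply: Rle_trans (IHk (Y :\ e) _ _) _.
- by move: Yk; rewrite (cardsD1 e) Ye => -[].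
- apply/subsetP=> a Xa; rewrite !inE (subsetP sXY) // andbT.
  by apply: contraNneq Xe => <-.
- by have := step e Y; rewrite setUC; have -> : Y :|: [set e] = Y; [apply/setUidPl; rewrite sub1set|].
Qed.

Lemma setU1D1 e X : e |: (X :\ e) = e |: X.
Proof. by apply/setP=> a; rewrite !inE; case: (a == e). Qed.

Lemma setD1U1 e X : (e |: X) :\ e = X :\ e.
Proof. by apply/setP=> a; rewrite !inE; case: (a == e). Qed.

Lemma setU1U1 e X : e |: (e |: X) = e |: X.
Proof. by apply/setP=> a; rewrite !inE; case: (a == e). Qed.

Lemma setD1D1 e X : (X :\ e) :\ e = X :\ e.
Proof. by apply/setP=> a; rewrite !inE; case: (a == e). Qed.

Lemma setU1D1_swap e d X : e != d -> (d |: X) :\ e = d |: (X :\ e).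
Proof.
by move=> ne; apply/setP=> a; rewrite !inE; have [->|] := eqVneq a e; rewrite ?(negbTE ne) ?andbT.
Qed.

Lemma setU1_swap e d X : e |: (d |: X) = d |: (e |: X).
Proof. by apply/setP=> a; rewrite !inE orbCA. Qed.

Lemma setD1_swap e d X : (X :\ e) :\ d = (X :\ d) :\ e.
Proof. by apply/setP=> a; rewrite !inE andbCA. Qed.

Lemma sizeR_U1 e X : sizeR (e |: X) = sizeR (X :\ e) + 1.
Proof. by rewrite /sizeR -setU1D1 cardsU1 !inE eqxx plus_INR /= Rplus_comm. Qed.

Lemma sizeR_D1 e X : sizeR (X :\ e) = sizeR X - ind (e \in X).
Proof. by rewrite /sizeR (cardsD1 e X) plus_INR /ind; case: (e \in X) => /=; lra. Qed.

Lemma sizeR_sum X : \rsum_(e : T) ind (e \in X) = sizeR X.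
Proof.
rewrite (eq_bigr (fun e => ind (e \in X) * 1)) => [|e _]; last by rewrite Rmult_1_r.
by rewrite -(rsum_ind (mem X) (fun _ => 1)) rsum_const Rmult_1_r.
Qed.

Lemma upd_lin r e f h a b X :
  upd r e (fun Y => a * f Y + b * h Y) X = a * upd r e f X + b * upd r e h X.
Proof. by rewrite /upd; ring. Qed.

Lemma upd_const r e a X : upd r e (fun=> a) X = a.
Proof. by rewrite /upd; ring. Qed.

Lemma upd_le r e f h X : 0 <= r X <= 1 -> (forall Y, f Y <= h Y) -> upd r e f X <= upd r e h X.
Proof. by move=> r01 fh; rewrite /upd; have := fh (e |: X); have := fh (X :\ e); nra. Qed.

End Functions.

Section Dynamics.
Variable T : finType.
Hypothesis T_gt0 : (0 < #|T|)%N.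
Notation state := {set T}.
Notation sites := (INR #|T|).
Implicit Types (X Y : state) (f h : state -> R) (e d : T) (g : T -> state -> R).

Lemma sites_ge1 : 1 <= sites.
Proof. by apply: (le_INR 1); apply/leP. Qed.

Lemma sites_neq0 : sites <> 0.
Proof. by have := sites_ge1; lra. Qed.

Definition step g f X : R := / sites * (\rsum_(e : T) upd (g e) e f X).
Definition evolve g t f := iter t (step g) f.

(* The update probability at [e] may not depend on whether [e] is present. *)
Definition rates g := forall e X,
  0 <= g e X <= 1 /\ g e (e |: X) = g e (X :\ e).

Section Fixed.
Variable g : T -> state -> R.
Hypothesis g_rates : rates g.

Lemma rate01 e X : 0 <= g e X <= 1. Proof. exact: (g_rates e X).1. Qed.

Lemma average_const (a : R) : / sites * (\rsum_(e : T) a) = a.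
Proof. by rewrite rsum_constT -Rmult_assoc Rinv_l ?Rmult_1_l //; have := sites_ge1; rewrite /=; lra. Qed.

Lemma average_le (F G : T -> R) : (forall e, F e <= G e) ->
  / sites * (\rsum_(e : T) F e) <= / sites * (\rsum_(e : T) G e).
Proof.
move=> FG; apply: Rmult_le_compat_l; last exact: rsum_le.
by apply/Rlt_le/Rinv_0_lt_compat; have := sites_ge1; lra.
Qed.

Lemma step_lin f h a b X :
  step g (fun Y => a * f Y + b * h Y) X = a * step g f X + b * step g h X.
Proof.
rewrite /step (eq_bigr _ (fun e _ => upd_lin (g e) e f h a b X)) big_split /=.
by rewrite -!rsum_distrr; ring.
Qed.

Lemma step_const a X : step g (fun=> a) X = a.
Proof. by rewrite /step (eq_bigr _ (fun e _ => upd_const (g e) e a X)) average_const. Qed.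

Lemma step_le f h : (forall X, f X <= h X) -> forall X, step g f X <= step g h X.
Proof. by move=> fh X; apply: average_le => e; apply: upd_le => //; apply: rate01. Qed.

Lemma evolveS t f : evolve g t.+1 f = step g (evolve g t f). Proof. by []. Qed.
Lemma evolveSr t f : evolve g t.+1 f = evolve g t (step g f). Proof. exact: iterSr. Qed.
Lemma evolve_le t f h : (forall X, f X <= h X) -> forall X, evolve g t f X <= evolve g t h X.
Proof. by move=> fh; elim: t => // t IHt X; apply: step_le. Qed.

Lemma evolve_lin t f h a b X :
  evolve g t (fun Y => a * f Y + b * h Y) X = a * evolve g t f X + b * evolve g t h X.
Proof.
elim: t X => // t IHt X; rewrite !evolveS -step_lin.
by congr step; apply: functional_extensionality.
Qed.

Lemma evolve_const t a X : evolve g t (fun=> a) X = a.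
Proof.
elim: t X => // t IHt X; rewrite evolveS -[RHS](step_const a X).
by congr step; apply: functional_extensionality.
Qed.

Lemma evolve_bound t f a b : (forall X, a <= f X <= b) -> forall X, a <= evolve g t f X <= b.
Proof.
move=> fab X; split.
  by rewrite -(evolve_const t a X); apply: evolve_le => Y; have := fab Y; lra.
by rewrite -[X in _ <= X](evolve_const t b X); apply: evolve_le => Y; have := fab Y; lra.
Qed.

Lemma step_size X :
  step g (@sizeR T) X = (1 - / sites) * sizeR X + / sites * (\rsum_(e : T) g e X).
Proof.
have s1 := sites_ge1.
rewrite /step (eq_bigr (fun e => (sizeR X - ind (e \in X)) + g e X)) => [|e _]; last first.
  by rewrite /upd sizeR_U1 -sizeR_D1; ring.
rewrite big_split rsum_sub sizeR_sum rsum_constT /=.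
by field; exact: sites_neq0.
Qed.

(** Discrete product rule: a change at [d] passes through the resampling of [e], and the last term
    records that it also shifts the rate at [e]. *)
Lemma dif_upd e d f X : e != d ->
  dif d (upd (g e) e f) X =
    g e (d |: X) * dif d f (e |: X) + (1 - g e (d |: X)) * dif d f (X :\ e)
    + dif d (g e) X * dif e f (X :\ d).
Proof.
move=> ne; rewrite /dif /upd.
rewrite [e |: (d |: X)]setU1_swap (setU1D1_swap _ ne) [(X :\ e) :\ d]setD1_swap.
by rewrite -(setU1D1_swap X (_ : d != e)) 1?eq_sym //; ring.
Qed.

Lemma dif_upd_same e f X : dif e (upd (g e) e f) X = 0.
Proof.
by rewrite /dif /upd setU1U1 setD1U1 setU1D1 setD1D1 (g_rates e X).2; ring.
Qed.

Lemma dif_step d f X : dif d (step g f) X = / sites * (\rsum_(e : T) dif d (upd (g e) e f) X).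
Proof. by rewrite /dif /step rsum_sub; ring. Qed.

(** Choosing [e = d] erases the discrepancy at [d], which yields the - 1 / N; every other choice
    keeps it at most [L] and adds [L] times the change of that rate, and these changes sum to at
    most [C]. *)
Lemma lip_step f L C : 0 <= L -> lip f L ->
  (forall d X, \rsum_(e : T) Rabs (dif d (g e) X) <= C) ->
  lip (step g f) ((1 - / sites + C / sites) * L).
Proof.
move=> L0 fL gC d X; have s1 := sites_ge1.
have si : 0 < / sites by apply: Rinv_0_lt_compat; lra.
rewrite dif_step Rabs_mult (Rabs_pos_eq (/ sites)); last by lra.
apply: Rle_trans (Rmult_le_compat_l _ _ _ (Rlt_le _ _ si) (rsum_abs _ _)) _.
apply: Rle_trans (_ : / sites * (\rsum_(e : T) ((1 - ind (e == d)) * L + L * Rabs (dif d (g e) X))) <= _).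
  apply: average_le => e; have [->|ne] := eqVneq e d.
    rewrite dif_upd_same Rabs_R0 /=.
    by have := Rabs_pos (dif d (g d) X); nra.
  rewrite dif_upd //=; have := rate01 e (d |: X).
  have := fL d (e |: X); have := fL d (X :\ e); have := fL e (X :\ d).
  move: (g e _) (dif d f _) (dif d f _) (dif e f _) (dif d (g e) X) => r a b c z.
  move=> hc hb ha r01; apply: Rle_trans (Rabs_triang _ _) _.
  rewrite Rabs_mult; apply: Rplus_le_compat; last first.
    by rewrite Rmult_comm; apply: Rmult_le_compat_r => //; apply: Rabs_pos.
  apply: Rle_trans (Rabs_triang _ _) _.
  by rewrite !Rabs_mult !(Rabs_pos_eq r) ?(Rabs_pos_eq (1 - r)); nra.
rewrite big_split -rsum_distrr /=.
rewrite (eq_bigr (fun e => L - ind (e == d) * L)) => [|e _]; last by lra.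
rewrite rsum_sub (rsum_eqop d (fun=> L)) rsum_constT /=.
have := gC d X; move: (bigop _ _ _) => z zC.
have -> : / sites * (sites * L - L + L * z) = (1 - / sites) * L + / sites * (L * z) by field; exact: sites_neq0.
have : / sites * (L * z) <= / sites * (L * C) by apply: Rmult_le_compat_l; [lra | nra].
by rewrite /Rdiv; move: (/ sites) => i; lra.
Qed.

End Fixed.

Section Monotone.
Variable g : T -> state -> R.
Hypotheses (g_rates : rates g) (g_inc : forall e, inc (g e)).

Lemma step_inc f : inc f -> inc (step g f).
Proof.
move=> f_inc X Y sXY; apply: average_le => e; rewrite /upd.
have := rate01 g_rates e X; have := rate01 g_rates e Y; have := g_inc e sXY.
have := f_inc _ _ (setUS [set e] sXY); have := f_inc _ _ (setSD [set e] sXY).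
have : f (X :\ e) <= f (e |: X) by apply: f_inc; apply: subset_trans (subD1set _ _) (subsetUr _ _).
by nra.
Qed.

Lemma evolve_inc t f : inc f -> inc (evolve g t f).
Proof. by move=> f_inc; elim: t => //= t; apply: step_inc. Qed.

Lemma sizeR_inc : inc (@sizeR T).
Proof. by move=> X Y sXY; apply: le_INR; apply/leP; apply: subset_leq_card. Qed.

Definition spread t := evolve g t (@sizeR T) [set: T] - evolve g t (@sizeR T) set0.

Lemma spreadS t : spread t.+1 = (1 - / sites) * spread t + / sites *
  (evolve g t (fun X => \rsum_(e : T) g e X) [set: T] - evolve g t (fun X => \rsum_(e : T) g e X) set0).
Proof.
rewrite /spread !evolveSr.
have -> : step g (@sizeR T) =
  fun X => (1 - / sites) * sizeR X + / sites * (fun Z => \rsum_(e : T) g e Z) X.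
  by apply: functional_extensionality => X; rewrite step_size.
by rewrite !evolve_lin; ring.
Qed.

(** The total rate is increasing, so the last term of [spreadS] is nonnegative and the spread loses
    at most the factor 1 - 1 / N per step. *)
Lemma spread_lower t : sites * (1 - / sites) ^ t <= spread t.
Proof.
have s1 := sites_ge1.
have si : 0 < / sites <= 1.
  by split; [apply: Rinv_0_lt_compat; lra | rewrite -Rinv_1; apply: Rinv_le_contravar; lra].
elim: t => [|t IHt]; first by rewrite /spread /= /sizeR cardsT cards0 /=; lra.
rewrite spreadS -tech_pow_Rmult.
have G_inc : inc (fun X => \rsum_(e : T) g e X).
  by move=> X Y sXY; apply: rsum_le => e _; apply: g_inc.
have := evolve_inc t G_inc (sub0set [set: T]).
by move: (evolve _ _ _ _) (evolve _ _ _ _) => a b; nra.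
Qed.

(* [2 |X| + f] is increasing for every [f] with values in [[-1,1]], so the
   increasing function [|X|] controls the total variation distance. *)
Lemma evolve_osc t f X Y : (forall Z, Rabs (f Z) <= 1) ->
  evolve g t f X - evolve g t f Y <= 4 * spread t.
Proof.
move=> f1.
have osc a Z : a = 1 \/ a = -1 -> a * (evolve g t f Z - evolve g t f set0) <= 2 * spread t.
  move=> a1; pose h (W : state) := 2 * sizeR W + (- a) * f W.
  have h_inc : inc h.
    apply: inc_step => e W; rewrite /h sizeR_U1.
    have := f1 (e |: W); have := f1 (W :\ e); rewrite /Rabs.
    by do 2!case: Rcase_abs; case: a1 => ->; lra.
  have := evolve_inc t h_inc (sub0set Z); rewrite /h !evolve_lin.
  have := evolve_inc t sizeR_inc (subsetT Z); rewrite /spread; lra.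
have := osc 1 X (or_introl erefl); have := osc (-1) Y (or_intror erefl).
by lra.
Qed.

End Monotone.

(** * Variance along the chain *)

Section Variance.
Variable g : T -> state -> R.
Hypothesis g_rates : rates g.

Lemma dif_neighbours h L : lip h L -> forall e X,
  Rabs (h (e |: X) - h X) <= L /\ Rabs (h (X :\ e) - h X) <= L.
Proof.
move=> hL e X; have L0 : 0 <= L := Rle_trans _ _ _ (Rabs_pos _) (hL e X).
have := hL e X; rewrite /dif; have [Xe|Xe] := boolP (e \in X).
  have -> : e |: X = X by apply/setUidPr; rewrite sub1set.
  by rewrite Rminus_diag Rabs_R0 Rabs_minus_sym.
have -> : X :\ e = X by apply/setP=> a; rewrite !inE; case: eqP => // ->; rewrite (negbTE Xe).
by rewrite Rminus_diag Rabs_R0.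
Qed.

(** The variance is at most the second moment about any constant; about [h X] it is at most [L ^ 2],
    since one step changes a single site. *)
Lemma step_square h L X : lip h L ->
  step g (fun Y => h Y ^ 2) X <= step g h X ^ 2 + L ^ 2.
Proof.
move=> hL.
have lin a : step g (fun Y => h Y ^ 2) X = step g (fun Y => (h Y - a) ^ 2) X
                                           + 2 * a * step g h X - a ^ 2.
  have -> : step g (fun Y => h Y ^ 2) X =
    step g (fun Y => 1 * (h Y - a) ^ 2 + 1 * (2 * a * h Y + (- a ^ 2) * 1)) X.
    by congr step; apply: functional_extensionality => Y; ring.
  by rewrite !step_lin step_const; ring.
rewrite (lin (h X)).
have : step g (fun Y => (h Y - h X) ^ 2) X <= L ^ 2.
  rewrite -[X in _ <= X]average_const; apply: average_le => e; rewrite /upd.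
  have [h1 h2] := dif_neighbours hL e X.
  have [? ?] := rate01 g_rates e X.
  have := pow_maj_Rabs _ _ 2 h1; have := pow_maj_Rabs _ _ 2 h2; nra.
have := Rle_0_sqr (step g h X - h X); rewrite /Rsqr; lra.
Qed.

(** Conditioning on the first step splits off the one-step variance of [evolve g t f], whose
    Lipschitz constant is at most (1 + C / N)^t. All t contributions are bounded by the largest
    power. *)
Lemma evolve_variance f C t : 0 <= C -> lip f 1 ->
  (forall d X, \rsum_(e : T) Rabs (dif d (g e) X) <= C) -> forall X,
  evolve g t (fun Y => f Y ^ 2) X
    <= evolve g t f X ^ 2 + INR t * ((1 + C / sites) ^ t) ^ 2.
Proof.
move=> C0 f1 gC; have s1 := sites_ge1.
have si : 0 < / sites by apply: Rinv_0_lt_compat; lra.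
have Cs : 0 <= C / sites by apply: Rmult_le_pos; lra.
have L_ge1 u : 1 <= (1 + C / sites) ^ u by apply: pow_R1_Rle; lra.
have f_lip u : lip (evolve g u f) ((1 + C / sites) ^ u).
  elim: u => [|u IHu]; first exact: f1.
  move=> d X; apply: Rle_trans (lip_step g_rates _ IHu gC d X) _.
    by have := L_ge1 u; lra.
  by rewrite -tech_pow_Rmult; apply: Rmult_le_compat_r; [have := L_ge1 u; lra | lra].
elim: t => [|t IHt] X; first by rewrite /=; lra.
have f_lipt := f_lip t; have L1 := L_ge1 t; move: f_lipt L1 IHt.
rewrite !evolveS -(tech_pow_Rmult _ t); move: (_ ^ t) => L f_lipt L1 IHt.
apply: Rle_trans (step_le g_rates
  (h := fun Y => 1 * evolve g t f Y ^ 2 + (INR t * L ^ 2) * 1) _ X) _.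
  by move=> Y; have := IHt Y; lra.
rewrite (step_lin g (fun Y => evolve g t f Y ^ 2) (fun=> 1)) step_const.
have := step_square X f_lipt.
have : L ^ 2 <= ((1 + C / sites) * L) ^ 2 by apply: pow_incr; nra.
by rewrite S_INR; move: (pow (_ * L) 2) => M; have := pos_INR t; nra.
Qed.

End Variance.

End Dynamics.

(** * Reversible laws *)

Section Stationarity.
Variable T : finType.
Hypothesis T_gt0 : (0 < #|T|)%N.
Notation state := {set T}.
Notation sites := (INR #|T|).
Implicit Types (X Y : state) (f h : state -> R) (e d : T).
Variable g : T -> state -> R.
Hypothesis g_rates : rates g.

(** Groups the states that differ only at [e], so that detailed balance can be applied pair by
    pair. *)
Lemma rsum_pair e f :
  \rsum_(X : {set T}) f X = \rsum_(X : {set T} | e \notin X) (f (e |: X) + f (X :\ e)).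
Proof.
rewrite (bigID (fun X => e \in X)) big_split /=; congr (_ + _).
  rewrite (reindex_onto (fun X => e |: X) (fun X => X :\ e)) /= => [|X eX]; last first.
    by rewrite setU1D1; apply/setUidPr; rewrite sub1set.
  apply: eq_bigl => X; rewrite setU11 /=.
  apply/eqP/idP => [<-|eX]; first by rewrite !inE eqxx.
  by rewrite setD1U1; apply/setP=> a; rewrite !inE; case: eqP => // ->; rewrite (negbTE eX).
apply: eq_bigr => X eX; congr f.
by apply/setP=> a; rewrite !inE; case: eqP => // ->; rewrite (negbTE eX).
Qed.

Lemma stationary_step (w : state -> R) f :
  (forall e X, w (e |: X) * (1 - g e X) = w (X :\ e) * g e X) ->
  \rsum_(X : {set T}) (w X * step g f X) = \rsum_(X : {set T}) (w X * f X).
Proof.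
move=> balance.
have upd_bal e : \rsum_(X : {set T}) (w X * upd (g e) e f X) = \rsum_(X : {set T}) (w X * f X).
  rewrite !(rsum_pair e); apply: eq_bigr => X _.
  rewrite /upd setU1U1 setD1U1 setU1D1 setD1D1 (g_rates e X).2.
  have := balance e (X :\ e); rewrite setU1D1 setD1D1.
  move: (w _) (w _) (f _) (f _) (g e _) => b a v u r bal.
  (* The discrepancy is the defect of detailed balance times u - v. *)
  have -> : a * (r * u + (1 - r) * v) + b * (r * u + (1 - r) * v) =
    a * u + b * v + (b * r - a * (1 - r)) * (u - v) by ring.
  by rewrite bal; ring.
rewrite (eq_bigr (fun X => / sites * (\rsum_(e : T) (w X * upd (g e) e f X)))) => [|X _]; last first.
  by rewrite /step -rsum_distrr; ring.
rewrite -rsum_distrr exchange_big /=.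
by rewrite (eq_bigr (fun _ => \rsum_(X : {set T}) (w X * f X))) // average_const.
Qed.

Lemma stationary_evolve (w : state -> R) t f :
  (forall e X, w (e |: X) * (1 - g e X) = w (X :\ e) * g e X) ->
  \rsum_(X : {set T}) (w X * evolve g t f X) = \rsum_(X : {set T}) (w X * f X).
Proof. by move=> bal; elim: t => // t IHt; rewrite evolveS stationary_step. Qed.

(** Stationarity rewrites the equilibrium mean of [f] as the [w]-average of [evolve g t f] over
    starting states, which reduces the claim to comparing two starts by [evolve_osc]. *)
Lemma distance_to_stationary (w : state -> R) t f x a : (forall e, inc (g e)) ->
  (forall e X, w (e |: X) * (1 - g e X) = w (X :\ e) * g e X) ->
  (forall X, 0 <= w X) -> \rsum_(X : {set T}) w X = 1 ->
  (forall Z, Rabs (f Z) <= 1) -> 4 * spread g t <= a ->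
  evolve g t f x - \rsum_(X : {set T}) (w X * f X) <= a.
Proof.
move=> g_inc bal w_ge0 w1 f1 le_a.
rewrite -(stationary_evolve t f bal).
have -> : evolve g t f x = \rsum_(X : {set T}) (w X * evolve g t f x).
  rewrite (eq_bigr (fun X => evolve g t f x * w X)) => [|X _]; last exact: Rmult_comm.
  by rewrite -rsum_distrr w1 Rmult_1_r.
rewrite -rsum_sub -[a]Rmult_1_l -w1 Rmult_comm rsum_distrr.
apply: rsum_le => X _.
have := evolve_osc T_gt0 g_rates g_inc t x X f1; have := w_ge0 X; nra.
Qed.

End Stationarity.

(** * Contraction of the spread on an order-convex set *)

Section Contraction.
Variable T : finType.
Hypothesis T_gt0 : (0 < #|T|)%N.
Notation state := {set T}.
Notation sites := (INR #|T|).
Implicit Types (X Y : state) (f h : state -> R) (e d : T).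
Variable g : T -> state -> R.
Hypotheses (g_rates : rates g) (g_inc : forall e, inc (g e)).
(** [U] will say that no subgraph count is too small, [W] that none is too large. Each is required
    to be likely only from the start that is worst for it. *)
Variables (U W : pred state) (delta eta : R) (t0 : nat).
Hypotheses (delta01 : 0 < delta <= 1) (eta0 : 0 <= eta).
Hypothesis U_up : forall X Y, X \subset Y -> U X -> U Y.
Hypothesis W_down : forall X Y, X \subset Y -> W Y -> W X.
Hypothesis contr : forall e X, U (X :\ e) -> W (e |: X) ->
  \rsum_(d : T) dif e (g d) X <= 1 - delta.
Hypothesis W_likely : forall t, (t0 <= t)%N -> evolve g t (fun X => ind (~~ W X)) [set: T] <= eta.
Hypothesis U_likely : forall t, (t0 <= t)%N -> evolve g t (fun X => ind (~~ U X)) set0 <= eta.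

Let G X := \rsum_(d : T) g d X.
Let L X := (1 - delta) * sizeR X - G X.
(* [L] is increasing on the order-convex set [U /\ W]; this is an increasing
   extension to all states. *)
Let L' X := if ~~ W X then sites else if ~~ U X then - sites else L X.
Let bad X := ind (~~ W X) + ind (~~ U X).

Let sub_D1U1 e X : X :\ e \subset e |: X.
Proof. exact: subset_trans (subD1set _ _) (subsetUr _ _). Qed.

Lemma total_rate_bound X : 0 <= G X <= sites.
Proof.
split; first by apply: rsum_ge0 => e _; have := rate01 g_rates e X; lra.
rewrite -[sites]Rmult_1_r -rsum_constT; apply: rsum_le => e _; exact: (rate01 g_rates e X).2.
Qed.

Lemma sizeR_bound X : 0 <= sizeR X <= sites.
Proof. by split; [exact: pos_INR | apply/le_INR/leP/max_card]. Qed.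

Lemma slack_bound X : - sites <= L X <= sites.
Proof. by rewrite /L; have := total_rate_bound X; have := sizeR_bound X; nra. Qed.

(** [W] fails only upwards, where the value is N, and [U] only downwards, where it is - N; these
    bound [L] by [slack_bound]. Inside the set, [contr] says that adding [e] does not lower [L].
    Testing [W] first settles the states where both fail. *)
Lemma clipped_inc : inc L'.
Proof.
apply: inc_step => e X; rewrite /L'.
have sites_ge0 := pos_INR #|T|.
have [We|We] /= := boolP (W (e |: X)); last first.
  by have := slack_bound (X :\ e); case: (W _); case: (U _) => /=; lra.
rewrite (W_down (sub_D1U1 e X) We) /=.
have [Ue|Ue] /= := boolP (U (X :\ e)); last first.
  by have := slack_bound (e |: X); case: (U _) => /=; lra.
rewrite (U_up (sub_D1U1 e X) Ue) /= /L sizeR_U1.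
by have := contr Ue We; rewrite rsum_sub /G; lra.
Qed.

Lemma slack_close X : Rabs (L X - L' X) <= 2 * sites * bad X.
Proof.
have := slack_bound X; rewrite /L' /bad; have sites_ge0 := pos_INR #|T|.
by case: (W X); case: (U X) => /=; rewrite /Rabs; case: Rcase_abs; lra.
Qed.

(** Failure of [W] is an increasing event and failure of [U] a decreasing one, so each bound extends
    to the opposite start. *)
Lemma bad_unlikely t : (t0 <= t)%N ->
  evolve g t bad [set: T] <= 2 * eta /\ evolve g t bad set0 <= 2 * eta.
Proof.
move=> le_t.
have -> : bad = fun X => 1 * (fun Y => ind (~~ W Y)) X + 1 * (fun Y => ind (~~ U Y)) X.
  by apply: functional_extensionality => X; rewrite /bad; lra.
rewrite !evolve_lin; have hW := W_likely le_t; have hU := U_likely le_t.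
have W_inc : inc (fun X => ind (~~ W X)).
  move=> X Y sXY; case: (boolP (W Y)) => WY; last by have := ind_bound (~~ W X) => /=; lra.
  by rewrite (W_down sXY WY) /=; lra.
have U_dec : inc (fun X => 0 * (fun=> 0) X + -1 * (fun X => ind (~~ U X)) X).
  move=> X Y sXY; case: (boolP (U X)) => UX; last by have := ind_bound (~~ U Y) => /=; lra.
  by rewrite (U_up sXY UX) /=; lra.
have := evolve_inc T_gt0 g_rates g_inc t W_inc (sub0set [set: T]).
have := evolve_inc T_gt0 g_rates g_inc t U_dec (sub0set [set: T]).
by rewrite !evolve_lin evolve_const //; lra.
Qed.

Lemma evolve_slack_close t X :
  Rabs (evolve g t L X - evolve g t L' X) <= 2 * sites * evolve g t bad X.
Proof.
have le_dif c : c = 1 \/ c = -1 ->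
    c * (evolve g t L X - evolve g t L' X) <= 2 * sites * evolve g t bad X.
  move=> c1.
  have le_LL' Y : c * L Y + - c * L' Y <= (2 * sites) * bad Y + 0 * bad Y.
    by have := slack_close Y; rewrite /Rabs; case: Rcase_abs; case: c1 => ->; lra.
  by have := evolve_le T_gt0 g_rates t le_LL' X; rewrite !evolve_lin; lra.
have := le_dif 1 (or_introl erefl); have := le_dif (-1) (or_intror erefl).
by rewrite /Rabs; case: Rcase_abs; lra.
Qed.

Lemma spread_contract t : (t0 <= t)%N ->
  spread g t.+1 <= (1 - delta / sites) * spread g t + 8 * eta.
Proof.
move=> le_t; have s1 := sites_ge1 T_gt0.
have [badT bad0] := bad_unlikely le_t.
have := evolve_inc T_gt0 g_rates g_inc t clipped_inc (sub0set [set: T]).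
have := evolve_slack_close t [set: T]; have := evolve_slack_close t set0.
have bad_nneg X : 0 <= evolve g t bad X.
  rewrite -[X in X <= _](evolve_const T_gt0 g t 0 X); apply: evolve_le => // Y.
  by rewrite /bad; have := ind_bound (~~ W Y); have := ind_bound (~~ U Y); lra.
have evL X : evolve g t L X = (1 - delta) * evolve g t (@sizeR T) X - evolve g t G X.
  have -> : L = fun Y => (1 - delta) * sizeR Y + -1 * G Y.
    by apply: functional_extensionality => Y; rewrite /L; ring.
  by rewrite evolve_lin; ring.
rewrite !evL => cl0 clT mon.
(* Replacing [L'] by [L] costs 2 N times 2 eta at each of the two starts, hence 8 eta N. *)
have difG : evolve g t G [set: T] - evolve g t G set0 <= (1 - delta) * spread g t + 8 * eta * sites.
  have b0 : 2 * sites * evolve g t bad set0 <= 2 * sites * (2 * eta) by nra.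
  have bT : 2 * sites * evolve g t bad [set: T] <= 2 * sites * (2 * eta) by nra.
  move: cl0 clT; rewrite /spread /Rabs; do 2!case: Rcase_abs; lra.
rewrite (spreadS T_gt0) //.
have si : 0 < / sites by apply: Rinv_0_lt_compat; lra.
have := Rmult_le_compat_l _ _ _ (Rlt_le _ _ si) difG.
have -> : / sites * ((1 - delta) * spread g t + 8 * eta * sites) =
  / sites * (1 - delta) * spread g t + 8 * eta by field; lra.
by rewrite /Rdiv -/G /G; lra.
Qed.

(** The additive term is the fixed point of x -> (1 - delta / N) x + 8 eta. *)
Lemma spread_upper u :
  spread g (t0 + u) <= sites * (1 - delta / sites) ^ u + 8 * eta * sites / delta.
Proof.
have s1 := sites_ge1 T_gt0.
have si : 0 < / sites <= 1.
  by split; [apply: Rinv_0_lt_compat; lra | rewrite -Rinv_1; apply: Rinv_le_contravar; lra].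
have ds : 0 <= 1 - delta / sites by rewrite /Rdiv; nra.
have err : 0 <= 8 * eta * sites / delta.
  by apply: Rmult_le_pos; [nra | apply/Rlt_le/Rinv_0_lt_compat; lra].
elim: u => [|u IHu].
  rewrite addn0 pow_O Rmult_1_r /spread.
  have h X := evolve_bound T_gt0 g_rates t0 sizeR_bound X.
  by have [_ hT] := h [set: T]; have [h0 _] := h set0; lra.
rewrite addnS; apply: Rle_trans (spread_contract (leq_addr _ _)) _.
have := Rmult_le_compat_l _ _ _ ds IHu; rewrite -(tech_pow_Rmult _ u).
have -> : (1 - delta / sites) * (sites * (1 - delta / sites) ^ u + 8 * eta * sites / delta)
  = sites * ((1 - delta / sites) * (1 - delta / sites) ^ u) + 8 * eta * sites / delta - 8 * eta.
  by field; lra.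
by lra.
Qed.

End Contraction.

(** * Independent edges and concentration *)

Section SubsetIndicator.
Variable T : finType.
Implicit Types (S X : {set T}) (e : T).

(** The monomial of [S] in the edge variables; all counts below are sums of these. *)
Definition subind S X : R := ind (S \subset X).

Lemma subind_U1 e S X : subind S (e |: X) = subind (S :\ e) X.
Proof. by rewrite /subind subDset setUC. Qed.

Lemma subind_D1 e S X : subind S (X :\ e) = ind (e \notin S) * subind S X.
Proof.
rewrite /subind subsetD1 andbC; case: (e \in S) => /=; ring.
Qed.

Lemma subind_inc S : inc (subind S).
Proof.
move=> X Y sXY; rewrite /subind; have [SX|_] /= := boolP (S \subset X).
  by rewrite (subset_trans SX sXY); apply: Rle_refl.
by have := ind_bound (S \subset Y); lra.
Qed.

(** Leibniz rule for the derivative of a monomial; injectivity leaves at most one nonzero term. *)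
Lemma dif_subind_imset (I : finType) (phi : I -> T) (S : {set I}) e X : injective phi ->
  dif e (subind (phi @: S)) X =
    \rsum_(a in S) (ind (phi a == e) * subind (phi @: (S :\ a)) X).
Proof.
move=> phi_inj; rewrite /dif subind_U1 subind_D1.
have [/imsetP[a aS ->]|eS] /= := boolP (e \in phi @: S).
  rewrite Rmult_0_l Rminus_0_r (bigD1 a) //= eqxx Rmult_1_l big1 => [|b /andP[_ ne]]; last first.
    by rewrite (inj_eq phi_inj) (negbTE ne) Rmult_0_l.
  rewrite Rplus_0_r; congr subind; apply/setP=> x; rewrite !inE.
  apply/andP/imsetP => [[ne /imsetP[b bS def_x]]|[b]].
    by exists b; rewrite // !inE bS andbT; apply: contraNneq ne => <-; apply/eqP.
  by rewrite !inE => /andP[ne bS] ->; rewrite (inj_eq phi_inj) ne imset_f.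
rewrite big1 => [|a aS]; last first.
  have [ea|_] /= := eqVneq (phi a) e; last by rewrite Rmult_0_l.
  by rewrite -ea imset_f in eS.
have -> : (phi @: S) :\ e = phi @: S.
  by apply/setP=> a; rewrite !inE; case: eqP => // ->; rewrite (negbTE eS).
by rewrite Rmult_1_l Rminus_diag.
Qed.

End SubsetIndicator.

Section Bernoulli.
Variable T : finType.
Hypothesis T_gt0 : (0 < #|T|)%N.
Notation state := {set T}.
Notation sites := (INR #|T|).
Implicit Types (X Y : state) (f h : state -> R) (e d : T) (l : seq T).
Variable q : R.
Hypothesis q01 : 0 <= q <= 1.

Notation resample := (upd (fun=> q)).

(** Expectation over independent Bernoulli(q) values on [l], the rest of the state being frozen.
    With the one-site operator of the dynamics as building block, invariance becomes a matter of
    commuting resamplings. *)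
Definition prodE l f : state -> R := foldl (fun h e => resample e h) f l.

(* The base point [set0] is irrelevant once every site has been resampled. *)
Definition bern f : R := prodE (enum T) f set0.

Lemma prodE_le l f h : (forall X, f X <= h X) -> forall X, prodE l f X <= prodE l h X.
Proof. by elim: l f h => //= e l IHl f h fh; apply: IHl => X; apply: upd_le. Qed.

Lemma prodE_lin l f h a b X :
  prodE l (fun Y => a * f Y + b * h Y) X = a * prodE l f X + b * prodE l h X.
Proof.
elim: l f h => //= e l IHl f h; rewrite -IHl; congr prodE.
by apply: functional_extensionality => Y; rewrite upd_lin.
Qed.

Lemma prodE_const l a X : prodE l (fun=> a) X = a.
Proof.
elim: l => //= e l IHl; rewrite -{2}IHl; congr prodE.
by apply: functional_extensionality => Y; rewrite upd_const.
Qed.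

Lemma prodE_sum (I : finType) l (F : I -> state -> R) X :
  prodE l (fun Y => \rsum_(i : I) F i Y) X = \rsum_(i : I) prodE l (F i) X.
Proof.
elim: l F => //= e l IHl F; rewrite -IHl; congr prodE.
by apply: functional_extensionality => Y; rewrite /upd !rsum_distrr -big_split.
Qed.

Lemma resample_comm e d f : resample e (resample d f) = resample d (resample e f).
Proof.
have [->//|ne] := eqVneq e d; apply: functional_extensionality => X; rewrite /upd.
rewrite [e |: (d |: X)]setU1_swap (setU1D1_swap _ ne) [(X :\ e) :\ d]setD1_swap.
by rewrite -(setU1D1_swap X (_ : d != e)) 1?eq_sym //; ring.
Qed.

Lemma resample_idem e f : resample e (resample e f) = resample e f.
Proof.
apply: functional_extensionality => X; rewrite /upd.
by rewrite setU1U1 setD1U1 setU1D1 setD1D1; ring.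
Qed.

Lemma prodE_resample l e f : e \in l -> prodE l (resample e f) = prodE l f.
Proof.
elim: l f => //= d l IHl f; rewrite inE; have [->|_] /= := eqVneq e d.
  by rewrite resample_idem.
by rewrite resample_comm; apply: IHl.
Qed.

Lemma bern_le f h : (forall X, f X <= h X) -> bern f <= bern h.
Proof. by move=> fh; apply: prodE_le. Qed.

Lemma bern_lin f h a b : bern (fun Y => a * f Y + b * h Y) = a * bern f + b * bern h.
Proof. exact: prodE_lin. Qed.

Lemma bern_const a : bern (fun=> a) = a.
Proof. exact: prodE_const. Qed.

(** The reference chain: state-independent rates, with Bernoulli(q) as invariant law. *)
Definition flat (_ : T) (_ : state) := q.

Lemma flat_rates : rates flat. Proof. by []. Qed.

Lemma flat_inc e : inc (flat e). Proof. by move=> X Y _; apply: Rle_refl. Qed.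

(** Resamplings commute and are idempotent, so one more of them is absorbed by [prodE (enum T)]. *)
Lemma bern_step f : bern (step flat f) = bern f.
Proof.
rewrite /bern.
have -> : step flat f = fun X => / sites * (fun Y => \rsum_(e : T) resample e f Y) X + 0 * 0.
  by apply: functional_extensionality => X; rewrite /step /flat; ring.
rewrite (prodE_lin _ _ (fun=> 0)) prodE_sum prodE_const.
rewrite (eq_bigr (fun=> prodE (enum T) f set0)) => [|e _]; last first.
  by rewrite prodE_resample // mem_enum.
by rewrite average_const //; ring.
Qed.

Lemma bern_evolve s f : bern (evolve flat s f) = bern f.
Proof. by elim: s => // s IHs; rewrite evolveS bern_step. Qed.

Lemma lip_osc f L X Y : 0 <= L -> lip f L -> f X - f Y <= 2 * sites * L.
Proof.
move=> L0 fL.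
have osc a Z : a = 1 \/ a = -1 -> a * (f Z - f set0) <= sites * L.
  move=> a1; pose h W := L * sizeR W + (- a) * f W.
  have h_inc : inc h.
    apply: inc_step => e W; rewrite /h sizeR_U1.
    have := fL e W; rewrite /dif /Rabs; case: Rcase_abs; case: a1 => ->; lra.
  have size0 : sizeR (set0 : state) = 0 by rewrite /sizeR cards0.
  have := h_inc _ _ (sub0set Z); rewrite /h size0.
  have : L * sizeR Z <= L * sites.
    by apply: Rmult_le_compat_l => //; apply/le_INR/leP/max_card.
  by lra.
have := osc 1 X (or_introl erefl); have := osc (-1) Y (or_intror erefl).
by lra.
Qed.

Lemma bounded01_lip f : bounded01 f -> lip f 1.
Proof.
move=> f01 e X; rewrite /dif; have := f01 (e |: X); have := f01 (X :\ e).
by rewrite /Rabs; case: Rcase_abs; lra.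
Qed.

Lemma lip_evolve_flat f s : bounded01 f -> lip (evolve flat s f) ((1 - / sites) ^ s).
Proof.
move=> f01; have s1 := sites_ge1 T_gt0.
have si : 0 < / sites <= 1.
  by split; [apply: Rinv_0_lt_compat; lra | rewrite -Rinv_1; apply: Rinv_le_contravar; lra].
elim: s => [|s IHs]; first exact: bounded01_lip.
have -> : (1 - / sites) ^ s.+1 = (1 - / sites + 0 / sites) * (1 - / sites) ^ s.
  by rewrite -tech_pow_Rmult /Rdiv; ring.
apply: (lip_step T_gt0 flat_rates) => // [|d X]; first by apply: pow_le; lra.
rewrite (eq_bigr (fun=> 0)) => [|e _]; last by rewrite /dif /flat Rminus_diag Rabs_R0.
by rewrite rsum_constT; lra.
Qed.

(** [bern f] is also the mean of [evolve flat s f], whose Lipschitz constant has decayed to (1 - 1 /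
    N)^s, so each value differs from the mean by at most the oscillation. *)
Lemma flat_mixing f s X c : c = 1 \/ c = -1 -> bounded01 f ->
  c * (evolve flat s f X - bern f) <= 2 * sites * (1 - / sites) ^ s.
Proof.
move=> c1 f01; have s1 := sites_ge1 T_gt0.
have si : 0 < / sites <= 1.
  by split; [apply: Rinv_0_lt_compat; lra | rewrite -Rinv_1; apply: Rinv_le_contravar; lra].
have L0 : 0 <= (1 - / sites) ^ s by apply: pow_le; lra.
rewrite -(bern_evolve s f); set h := evolve flat s f; set b := _ * (_ ^ s).
have osc Y Z : h Y - h Z <= b := lip_osc Y Z L0 (lip_evolve_flat s f01).
case: c1 => ->.
  have : bern (fun=> h X - b) <= bern h by apply: bern_le => Y; have := osc X Y; lra.
  by rewrite bern_const; lra.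
have : bern h <= bern (fun=> h X + b) by apply: bern_le => Y; have := osc Y X; lra.
by rewrite bern_const; lra.
Qed.

Lemma resample_subind e S : resample e (subind S) =
  if e \in S then fun X => q * subind (S :\ e) X + 0 * 0 else subind S.
Proof.
apply: functional_extensionality => X; rewrite /upd subind_U1 subind_D1.
have [eS|eS] /= := boolP (e \in S); first by ring.
have -> : S :\ e = S by apply/setP=> a; rewrite !inE; case: eqP => // ->; rewrite (negbTE eS).
by ring.
Qed.

Lemma bern_subind S : bern (subind S) = q ^ #|S|.
Proof.
rewrite /bern; have : {subset S <= enum T} by move=> e _; rewrite mem_enum.
elim: (enum T) S => [|e l IHl] S sSl /=.
  rewrite /subind; suff -> : S = set0 by rewrite sub0set cards0 /=.
  by apply/setP=> a; rewrite inE; apply/negP => /sSl.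
rewrite resample_subind; have [eS|eS] := boolP (e \in S).
  rewrite (prodE_lin l (subind (S :\ e)) (fun=> 0)) IHl => [|a].
    by rewrite (cardsD1 e S) eS add1n -tech_pow_Rmult prodE_const; ring.
  by rewrite !inE => /andP[ne /sSl]; rewrite inE (negbTE ne).
by apply: IHl => a aS; have := sSl a aS; rewrite inE; case: eqP => // ea; rewrite ea (negbTE eS) in aS.
Qed.

(** Combines exp x <= 1 / (1 - x) with (1 - x)(1 + x + 2 x^2) = 1 + x^2 (1 - 2 x). *)
Lemma exp_quadratic x : x <= / 2 -> exp x <= 1 + x + 2 * x ^ 2.
Proof.
move=> x2; have := exp_ineq1_le (- x); rewrite exp_Ropp => ex.
have p := exp_pos x; have : (1 - x) * exp x <= 1.
  have := Rmult_le_compat_r _ _ _ (Rlt_le _ _ p) ex; rewrite Rinv_l; lra.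
have : 1 <= (1 - x) * (1 + x + 2 * x ^ 2) by nra.
nra.
Qed.

(** With d the difference of the two values of [F], the centred values (1 - q) d and - q d have mean
    0, so only their quadratic terms survive, at most 2 q (1 - q) d^2. *)
Lemma resample_exp e F c X : lip F (/ 2) -> Rabs (dif e F X) <= c ->
  resample e (fun Y => exp (F Y)) X <= exp (resample e F X) * exp (2 * c ^ 2).
Proof.
move=> F2 Fc; rewrite -exp_plus /upd; have := F2 e X; rewrite /dif => le2.
have := Fc; rewrite /dif; set a := F (e |: X) in le2 *; set b := F (X :\ e) in le2 *.
move: a b le2 => a b le2 lec; pose d := a - b.
have -> : a = (q * a + (1 - q) * b) + (1 - q) * d by rewrite /d; ring.
have -> : exp b = exp ((q * a + (1 - q) * b) + - q * d) by congr exp; rewrite /d; ring.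
have -> : q * (q * a + (1 - q) * b + (1 - q) * d) + (1 - q) * b = q * a + (1 - q) * b.
  by rewrite /d; ring.
move: (q * a + _) => m; rewrite !exp_plus.
have em := exp_pos m.
have d2 : - / 2 <= d <= / 2 by move: le2; rewrite /d /Rabs; case: Rcase_abs; lra.
have dc : d ^ 2 <= c ^ 2 by apply: pow_maj_Rabs.
have x1 : exp ((1 - q) * d) <= 1 + (1 - q) * d + 2 * ((1 - q) * d) ^ 2 by apply: exp_quadratic; nra.
have x2 : exp (- q * d) <= 1 + (- q * d) + 2 * (- q * d) ^ 2 by apply: exp_quadratic; nra.
have x3 := exp_ineq1_le (2 * c ^ 2).
have q2 : q * (1 - q) <= 1 by nra.
have : q * exp ((1 - q) * d) + (1 - q) * exp (- q * d) <= exp (2 * c ^ 2).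
  apply: Rle_trans x3.
  have : q * exp ((1 - q) * d) <= q * (1 + (1 - q) * d + 2 * ((1 - q) * d) ^ 2) by nra.
  have : (1 - q) * exp (- q * d) <= (1 - q) * (1 + (- q * d) + 2 * (- q * d) ^ 2) by nra.
  have -> : q * (1 + (1 - q) * d + 2 * ((1 - q) * d) ^ 2) =
     q + q * (1 - q) * d + 2 * (q * (1 - q)) * ((1 - q) * d ^ 2) by ring.
  have -> : (1 - q) * (1 + - q * d + 2 * (- q * d) ^ 2) =
     1 - q - q * (1 - q) * d + 2 * (q * (1 - q)) * (q * d ^ 2) by ring.
  have : q * (1 - q) * d ^ 2 <= c ^ 2 by have := pow2_ge_0 d; nra.
  by lra.
move: (exp (2 * _)) (exp _) (exp _) => E A B le_E.
by have := Rmult_le_compat_l _ _ _ (Rlt_le _ _ em) le_E; lra.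
Qed.

Lemma dif_resample d e F X c : (forall Y, Rabs (dif d F Y) <= c) -> Rabs (dif d (resample e F) X) <= c.
Proof.
move=> Fc; have [->|ne] := eqVneq e d.
  rewrite (dif_upd_same flat_rates) Rabs_R0; exact: Rle_trans (Rabs_pos _) (Fc X).
rewrite (dif_upd (flat)) // /flat {3}/dif Rminus_diag Rmult_0_l Rplus_0_r.
apply: Rle_trans (Rabs_triang _ _) _; rewrite !Rabs_mult !(Rabs_pos_eq q) ?(Rabs_pos_eq (1 - q)); try lra.
by have := Fc (e |: X); have := Fc (X :\ e); nra.
Qed.

(** Sites are integrated out one at a time; averaging over a site does not increase any of the
    bounds [c] ([dif_resample]). *)
Lemma prodE_exp l F (c : T -> R) X : (forall e Y, Rabs (dif e F Y) <= c e) ->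
  (forall e, c e <= / 2) ->
  prodE l (fun Y => exp (F Y)) X
    <= exp (prodE l F X) * exp (2 * \big[Rplus/R0]_(e <- l) c e ^ 2).
Proof.
move=> Fc c2; elim: l F Fc => [|e l IHl] F Fc.
  by rewrite big_nil Rmult_0_r exp_0 /=; lra.
rewrite big_cons Rmult_plus_distr_l exp_plus /=.
apply: Rle_trans (prodE_le l (h := fun Y =>
  exp (2 * c e ^ 2) * exp (resample e F Y) + 0 * 0) _ X) _ => [Y|].
  rewrite Rmult_0_r Rplus_0_r Rmult_comm; apply: resample_exp => // d Z.
  exact: Rle_trans (c2 d).
rewrite (prodE_lin l (fun Y => exp (resample e F Y)) (fun=> 0)) Rmult_0_l Rplus_0_r.
have := IHl (resample e F) (fun d Y => dif_resample e Y (Fc d)).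
have := exp_pos (2 * c e ^ 2); move: (exp (2 * c e ^ 2)) => A A0 le_A.
by have := Rmult_le_compat_l _ _ _ (Rlt_le _ _ A0) le_A; rewrite /=; lra.
Qed.

(** Exponential Markov inequality with parameter [lam]; [lam * c e <= / 2] is the range in which
    [exp_quadratic] applies. *)
Lemma concentration F (c : T -> R) (v lam x : R) (B : pred state) :
  0 <= lam -> (forall e Y, Rabs (dif e F Y) <= c e) -> (forall e, lam * c e <= / 2) ->
  \rsum_(e : T) (c e ^ 2) <= v -> (forall Y, B Y -> bern F + x <= F Y) ->
  bern (fun Y => ind (B Y)) <= exp (2 * lam ^ 2 * v - lam * x).
Proof.
move=> lam0 Fc c2 cv FB.
pose H Y := lam * F Y + - (lam * (bern F + x)) * 1.
have Hexp : forall Y, ind (B Y) <= exp (H Y).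
  move=> Y; rewrite /H; case: (boolP (B Y)) => [/FB FY|_]; last exact: Rlt_le (exp_pos _).
  rewrite -[X in X <= _]exp_0; case: (Req_dec (H Y) 0) => [<-|HY]; first by apply: Rle_refl.
  by apply/Rlt_le/exp_increasing; rewrite /H in HY; nra.
apply: Rle_trans (bern_le Hexp) _.
have Hc e Y : Rabs (dif e H Y) <= lam * c e.
  have -> : dif e H Y = lam * dif e F Y by rewrite /dif /H; ring.
  by rewrite Rabs_mult (Rabs_pos_eq lam) //; apply: Rmult_le_compat_l.
apply: Rle_trans (prodE_exp (enum T) set0 Hc c2) _; rewrite -exp_plus.
have -> : prodE (enum T) H set0 = - (lam * x).
  by rewrite -/(bern H) /H (bern_lin F (fun=> 1)) bern_const; ring.
rewrite big_enum /= (eq_bigr (fun e => lam ^ 2 * c e ^ 2)) => [|e _]; last by ring.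
rewrite -rsum_distrr; have := Rmult_le_compat_l _ _ _ (pow2_ge_0 lam) cv.
move: (bigop _ _ _) => z le_z.
case: (Req_dec (- (lam * x) + 2 * (lam ^ 2 * z)) (2 * lam ^ 2 * v - lam * x)) => [->|ne].
  exact: Rle_refl.
by apply/Rlt_le/exp_increasing; lra.
Qed.

(** * Comparison with the constant-rate chain *)

Section Comparison.
Variable g : T -> state -> R.
Hypothesis g_rates : rates g.
Variables (c : R) (B : pred state).
Hypothesis c1 : c = 1 \/ c = -1.
Hypothesis gB : forall X, ~~ B X -> forall e, c * (g e X - q) <= 0.

(** Outside [B] all rates lie on one side of [q], so for increasing [f] the difference has a sign;
    on [B] it is at most 1. *)
Lemma step_compare f X : inc f -> bounded01 f ->
  c * (step g f X - step flat f X) <= ind (B X).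
Proof.
move=> f_inc f01; rewrite /step -(average_const T_gt0 (ind _)).
have -> : c * (/ sites * (\rsum_(e : T) upd (g e) e f X) - / sites * (\rsum_(e : T) upd (flat e) e f X))
  = / sites * (\rsum_(e : T) (c * (upd (g e) e f X - upd (flat e) e f X))).
  by rewrite -rsum_distrr rsum_sub; ring.
apply: average_le => // e; rewrite /upd /flat.
have d0 : f (X :\ e) <= f (e |: X) by apply: f_inc; apply: subset_trans (subD1set _ _) (subsetUr _ _).
have := f01 (e |: X); have := f01 (X :\ e); have := rate01 g_rates e X.
have -> : c * (g e X * f (e |: X) + (1 - g e X) * f (X :\ e) - (q * f (e |: X) + (1 - q) * f (X :\ e)))
  = (c * (g e X - q)) * (f (e |: X) - f (X :\ e)) by ring.
case: (boolP (B X)) => /= [_|/gB/(_ e)]; last by nra.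
move=> r01 h1 h2; have : c * (g e X - q) <= 1 by case: c1 => ->; lra.
by nra.
Qed.

(** Steps are exchanged one at a time, starting from the last; the remaining exchanges act on
    [step flat f], which is again increasing with values in [0,1]. Each exchange costs at most
    [eta]. *)
Lemma evolve_compare t s f x (eta : R) : inc f -> bounded01 f ->
  (forall u, (t <= u)%N -> evolve g u (fun X => ind (B X)) x <= eta) ->
  c * (evolve g (t + s) f x - evolve g t (evolve flat s f) x) <= INR s * eta.
Proof.
move=> f_inc f01 B_unlikely; elim: s f f_inc f01 => [|s IHs] f f_inc f01.
  by rewrite addn0 /=; lra.
have f_inc' : inc (step flat f) by apply: step_inc => //; apply: flat_inc.
have f01' : bounded01 (step flat f) by move=> Y; apply: (evolve_bound T_gt0 flat_rates 1 f01).
have := IHs _ f_inc' f01'; rewrite addnS evolveSr (evolveSr _ s) S_INR.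
have le_B Y : c * step g f Y + (- c) * step flat f Y <= ind (B Y).
  by have := step_compare Y f_inc f01; lra.
have := evolve_le T_gt0 g_rates (t + s) le_B x; rewrite evolve_lin.
by have := B_unlikely _ (leq_addr s t); lra.
Qed.

Lemma domination_transfer t s f x (eta : R) : inc f -> bounded01 f ->
  (forall u, (t <= u)%N -> evolve g u (fun X => ind (B X)) x <= eta) ->
  c * (evolve g (t + s) f x - bern f) <= INR s * eta + 2 * sites * (1 - / sites) ^ s.
Proof.
move=> f_inc f01 B_unlikely; have := evolve_compare s f_inc f01 B_unlikely.
have mixes X : c * (fun Y => evolve flat s f Y) X + (- c) * (fun=> bern f) X
    <= 2 * sites * (1 - / sites) ^ s.
  by have := flat_mixing s X c1 f01; lra.
have := evolve_le T_gt0 g_rates t mixes x; rewrite evolve_lin !evolve_const //.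
by lra.
Qed.

End Comparison.

End Bernoulli.

(** * Subgraph counts through a pair *)

Section Pairs.
Variable n : nat.
Implicit Types (e f d : pairT n) (x y : 'I_n).

Definition joins e x y :=
  ((sval e).1 == x) && ((sval e).2 == y) || ((sval e).1 == y) && ((sval e).2 == x).

(** The fallback [d] is reached only for x = y. *)
Definition mkpair d x y : pairT n :=
  insubd (d : {p : 'I_n * 'I_n | (p.1 < p.2)%N}) (if (x < y)%N then (x, y) else (y, x)).

Lemma pair_lt e : ((sval e).1 < (sval e).2)%N.
Proof. exact: (svalP e). Qed.

Lemma pair_neq e : (sval e).1 != (sval e).2.
Proof. by apply/eqP=> eq12; have := pair_lt e; rewrite eq12 ltnn. Qed.

Lemma joins_sval e : joins e (sval e).1 (sval e).2.
Proof. by rewrite /joins !eqxx. Qed.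

Lemma joins_mkpair d x y : x != y -> joins (mkpair d x y) x y.
Proof.
move=> ne; rewrite /joins /mkpair.
have [xy|yx] := ltnP x y; rewrite -/(val _) insubdK /= ?eqxx ?orbT //.
by rewrite unfold_in /= ltn_neqAle eq_sym yx andbT.
Qed.

Lemma joins_inj e f x y : joins e x y -> joins f x y -> e = f.
Proof.
case: e f => [[e1 e2] le] [[f1 f2] lf]; rewrite /joins /= in le lf *.
move=> he hf; apply: val_inj => /=; move: le lf.
case/orP: he => /andP[/eqP-> /eqP->]; case/orP: hf => /andP[/eqP-> /eqP->] // le lf.
  by move: (ltn_trans le lf); rewrite ltnn.
by move: (ltn_trans le lf); rewrite ltnn.
Qed.

Lemma joinsE d e x y : x != y -> joins e x y = (mkpair d x y == e).
Proof.
move=> ne; apply/idP/eqP => [je|<-]; last exact: joins_mkpair.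
exact: joins_inj (joins_mkpair d ne) je.
Qed.

Lemma card_pairT : #|pairT n| = 'C(n, 2).
Proof.
rewrite card_sig -bin2_sum -sum1_card.
rewrite (eq_bigl (fun p : 'I_n * 'I_n => true && (p.1 < p.2)%N)) => [|p]; last by rewrite inE.
rewrite -(pair_big_dep xpredT (fun i j : 'I_n => (i < j)%N) (fun _ _ => 1%N)) /=.
rewrite (exchange_big_dep xpredT) //= big_mkord; apply: eq_bigr => j _.
by rewrite -(big_ord_widen _ (fun=> 1%N) (ltnW (ltn_ord j))) sum_nat_const card_ord muln1.
Qed.

End Pairs.

Lemma pairT2_unique m (a b : pairT m) : m = 2%N -> a = b.
Proof.
move=> m2; have two (c : pairT m) : (sval c).1 = 0%N :> nat /\ (sval c).2 = 1%N :> nat.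
  have := pair_lt c; have := ltn_ord (sval c).2; rewrite [X in (_ < X)%N]m2.
  by case: (nat_of_ord (sval c).2) => [|[|?]] //; case: (nat_of_ord (sval c).1).
have [[b1 b2] [a1 a2]] := (two b, two a).
suff jb : joins b (sval a).1 (sval a).2 by apply: joins_inj (joins_sval a) jb.
by rewrite /joins -!val_eqE /= b1 b2 a1 a2.
Qed.

Section Patterns.
Variables (n m : nat) (d0 : pairT n).
Notation map := {ffun 'I_m -> 'I_n}.
Notation sites := (INR #|pairT n|).
Implicit Types (sigma : map) (a b : pairT m) (S : {set pairT m}) (e f : pairT n) (X : graph n).

Definition im sigma a : pairT n := mkpair d0 (sigma (sval a).1) (sigma (sval a).2).

Lemma map_neq sigma a : injectiveb sigma -> sigma (sval a).1 != sigma (sval a).2.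
Proof. by move=> /injectiveP inj; rewrite (inj_eq inj) pair_neq. Qed.

Lemma imE sigma a e : injectiveb sigma ->
  (im sigma a == e) = joins e (sigma (sval a).1) (sigma (sval a).2).
Proof. by move=> inj; rewrite (joinsE d0) ?map_neq. Qed.

Lemma im_inj sigma : injectiveb sigma -> injective (im sigma).
Proof.
move=> inj a b /esym/eqP; rewrite imE // => jb.
have ja : joins (im sigma a) (sigma (sval a).1) (sigma (sval a).2) by rewrite -imE.
suff jab : joins a (sval b).1 (sval b).2 by apply: joins_inj jab (joins_sval b).
have sig_eq := inj_eq (injectiveP _ inj).
move: ja jb; rewrite /joins.
case/orP=> /andP[/eqP-> /eqP->]; rewrite !sig_eq // => h.
by rewrite orbC andbC [X in _ || X]andbC.
Qed.

(** The edge [b] may land on [e] in either orientation; this is the origin of the factor 2 in all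
    limiting densities. *)
Definition through b e : pred map := fun sigma => injectiveb sigma && (im sigma b == e).

Lemma through_inj b e sigma : through b e sigma -> injective (im sigma).
Proof. by case/andP=> /im_inj. Qed.

(* Normalised number of copies through [e] (with [b] sent to [e]) whose
   remaining edges [S] are present. *)
Definition stat S b e X : R :=
  / INR n ^ (m - 2) * (\rsum_(sigma : map | through b e sigma) subind (im sigma @: S) X).

Definition density b e : R := / INR n ^ (m - 2) * INR #|through b e|.

Lemma scale_ge0 : 0 <= / INR n ^ (m - 2).
Proof.
have n_gt0 : 0 < INR n by apply/(lt_INR 0)/ltP; case: (n) d0 => [[[[]]]|//].
by apply/Rlt_le/Rinv_0_lt_compat/pow_lt.
Qed.

Lemma stat_inc S b e : inc (stat S b e).
Proof.
move=> X Y sXY; apply: Rmult_le_compat_l; first exact: scale_ge0.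
by apply: rsum_le => sigma _; apply: subind_inc.
Qed.

Lemma stat_bound S b e X : 0 <= stat S b e X <= density b e.
Proof.
split; [apply: Rmult_le_pos | apply: Rmult_le_compat_l]; try exact: scale_ge0.
  by apply: rsum_ge0 => sigma _; have := ind_bound (im sigma @: S \subset X); rewrite /subind; lra.
rewrite -[INR _]Rmult_1_r -rsum_const; apply: rsum_le => sigma _.
by have := ind_bound (im sigma @: S \subset X); rewrite /subind; lra.
Qed.

Lemma stat_set0 b e X : stat set0 b e X = density b e.
Proof.
rewrite /stat (eq_bigr (fun=> 1)) ?rsum_const ?Rmult_1_r // => sigma _.
by rewrite imset0 /subind sub0set.
Qed.

Lemma bern_stat q S b e : bern q (stat S b e) = q ^ #|S| * density b e.
Proof.
have -> : stat S b e = fun X => / INR n ^ (m - 2) *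
   (fun Y => \rsum_(sigma : map) (ind (through b e sigma) * subind (im sigma @: S) Y)) X + 0 * 0.
  by apply: functional_extensionality => X; rewrite /stat rsum_ind Rmult_0_l Rplus_0_r.
rewrite (bern_lin q _ (fun=> 0)) {1}/bern prodE_sum bern_const.
rewrite (eq_bigr (fun sigma => ind (through b e sigma) * q ^ #|S|)) => [|sigma _]; last first.
  rewrite -[fun _ => _](_ : (fun Y => ind (through b e sigma) * subind (im sigma @: S) Y + 0 * 0) = _); last first.
    by apply: functional_extensionality => X; ring.
  rewrite -/(bern q _) (bern_lin q _ (fun=> 0)) bern_const bern_subind.
  rewrite Rmult_0_l Rplus_0_r; have [/through_inj inj|_] := boolP (through b e sigma).
    by rewrite card_imset.
  by rewrite /= !Rmult_0_l.
rewrite -(rsum_ind (through b e) (fun=> q ^ #|S|)) rsum_const /density.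
by rewrite Rmult_0_l Rplus_0_r -Rmult_assoc Rmult_comm.
Qed.

Lemma dif_stat S b e f X : dif f (stat S b e) X = / INR n ^ (m - 2) *
  (\rsum_(sigma : map | through b e sigma)
    \rsum_(a in S) (ind (im sigma a == f) * subind (im sigma @: (S :\ a)) X)).
Proof.
rewrite /dif /stat -Rmult_minus_distr_l -rsum_sub; congr (_ * _).
by apply: eq_bigr => sigma /through_inj inj; rewrite -(dif_subind_imset S f X inj).
Qed.

(** Bounded-difference constant of [stat S b e] at [f], uniform in the graph. *)
Definition influence S b e f : R := / INR n ^ (m - 2) *
  (\rsum_(a in S) INR #|[pred sigma | through b e sigma && (im sigma a == f)]|).

Lemma dif_stat_bound S b e f X : 0 <= dif f (stat S b e) X <= influence S b e f.
Proof.
rewrite dif_stat; split; [apply: Rmult_le_pos | apply: Rmult_le_compat_l]; try exact: scale_ge0.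
  apply: rsum_ge0 => sigma _; apply: rsum_ge0 => a _.
  by apply: Rmult_le_pos; [have := ind_bound (im sigma a == f) | have := ind_bound (im sigma @: (S :\ a) \subset X); rewrite /subind]; lra.
rewrite exchange_big /=; apply: rsum_le => a _.
rewrite card_rsum; apply: rsum_le => sigma _.
have := ind_bound (im sigma @: (S :\ a) \subset X); rewrite /subind.
by move: (ind (_ \subset _)) (ind_bound (im sigma a == f)) => z h1 h2; nra.
Qed.

(** A map sends each edge of [S] to exactly one pair, so the total influence stays bounded although
    there are order n^2 pairs. *)
Lemma influence_sum S b e : \rsum_(f : pairT n) influence S b e f = INR #|S| * density b e.
Proof.
rewrite /influence -rsum_distrr exchange_big /=.
rewrite (eq_bigr (fun _ => INR #|through b e|)) => [|a _].
  by rewrite rsum_const_mem /density -Rmult_assoc [/ _ * _]Rmult_comm Rmult_assoc.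
rewrite -[RHS]Rmult_1_r -rsum_const.
rewrite (eq_bigr (fun f => \rsum_(sigma : map | through b e sigma) (ind (f == im sigma a) * 1))).
  rewrite exchange_big /=; apply: eq_bigr => sigma _.
  by rewrite (rsum_eqop (im sigma a) (fun=> 1)).
by move=> f _; rewrite card_rsum; apply: eq_bigr => sigma _; rewrite eq_sym Rmult_1_r.
Qed.

(** Some endpoint v of [a] is not an endpoint of [b]. The images of v and of the two ends of [b]
    have two choices each, the other m - 3 vertices at most n. *)
Lemma card_two_pairs a b e f : a != b ->
  (#|[pred sigma | through b e sigma && (im sigma a == f)]| <= expn 2 3 * expn n (m - 3))%N.
Proof.
move=> ne.
have [v va vb] : exists2 v, v \in [:: (sval a).1; (sval a).2] & v \notin [:: (sval b).1; (sval b).2].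
  have [|v1] := boolP ((sval a).1 \in [:: (sval b).1; (sval b).2]); last by exists (sval a).1; rewrite ?mem_head.
  have [|v2] := boolP ((sval a).2 \in [:: (sval b).1; (sval b).2]); last first.
    by exists (sval a).2; rewrite ?v2 // !inE eqxx orbT.
  rewrite !inE => a2 a1; case/eqP: ne; suff jab : joins a (sval b).1 (sval b).2 by apply: joins_inj jab (joins_sval b).
  have := pair_neq a; rewrite /joins.
  by case/orP: a1 => /eqP->; case/orP: a2 => /eqP->; rewrite !eqxx ?orbT.
pose ends (e : pairT n) : pred 'I_n := [pred x | (x == (sval e).1) || (x == (sval e).2)].
pose D := [set (sval b).1; (sval b).2; v].
pose F (i : 'I_m) : pred 'I_n := if i == v then ends f else if i \in D then ends e else predT.
have ends2 e' : (#|ends e'| <= 2)%N.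
  by rewrite (eq_card (_ : _ =i [set (sval e').1; (sval e').2])) ?cards2 ?pair_neq // => x; rewrite !inE.
have cD : #|D| = 3%N.
  by rewrite /D setUC cardsU1 cards2 pair_neq !inE; move: vb; rewrite !inE => ->.
apply: (@leq_trans #|finfun.family F|).
  apply: subset_leq_card; apply/subsetP => sigma; rewrite !inE /through => /andP[/andP[inj]].
  rewrite !imE // => jb ja; apply/familyP => i; rewrite /F.
  have [->|niv] := eqVneq i v.
    move: va ja; rewrite !inE /joins => /orP[/eqP->|/eqP->] /orP[] /andP[/eqP-> /eqP->];
    by rewrite eqxx ?orbT.
  rewrite !inE (negbTE niv) orbF; case: ifP => // ib.
  move: ib jb; rewrite !inE /joins => /orP[/eqP->|/eqP->] /orP[] /andP[/eqP-> /eqP->];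
  by rewrite eqxx ?orbT.
rewrite card_family foldrE big_map big_enum /=.
rewrite (bigID (mem D)) /= leq_mul //.
  rewrite -cD -prod_nat_const; apply: leq_prod => i iD; rewrite /F iD.
  by case: ifP => _; apply: ends2.
have -> : (m - 3 = #|~: D|)%N by rewrite -[in LHS](card_ord m) -[in LHS]cD -(cardsC D) addKn.
rewrite (eq_bigl (mem (~: D))) => [|i]; last by rewrite !inE.
rewrite -prod_nat_const; apply: leq_prod => i; rewrite inE in_setC => iD; rewrite /F (negbTE iD).
have -> : (i == v) = false by apply: contraNF iD => /eqP->; rewrite !inE eqxx !orbT.
by rewrite -[X in (_ <= X)%N](card_ord n) max_card.
Qed.

(** Composition with a vertex permutation carrying [e] to [f], built from two transpositions,
    injects one set into the other. *)
Lemma card_through_le b e f : (#|through b e| <= #|through b f|)%N.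
Proof.
pose s := (tperm (sval e).1 (sval f).1 * tperm (tperm (sval e).1 (sval f).1 (sval e).2) (sval f).2)%g.
have s1 : s (sval e).1 = (sval f).1.
  rewrite permM tpermL tpermD //; last by rewrite eq_sym pair_neq.
  by rewrite -{2}(tpermL (sval e).1 (sval f).1) (inj_eq perm_inj) eq_sym pair_neq.
have s2 : s (sval e).2 = (sval f).2 by rewrite permM tpermL.
pose push (sigma : map) : map := [ffun i => s (sigma i)].
have push_inj : injective push.
  move=> u v /ffunP uv; apply/ffunP => i; apply: (@perm_inj _ s).
  by have := uv i; rewrite !ffunE.
rewrite -(card_image push_inj); apply: subset_leq_card; apply/subsetP => _ /imageP[sigma thr ->].
move: thr; rewrite !unfold_in /through => /andP[inj].
have inj' : injectiveb (push sigma).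
  by apply/injectiveP => i j; rewrite !ffunE => /perm_inj/(injectiveP _ inj).
rewrite inj' /= !imE // /joins !ffunE -s1 -s2 !(inj_eq perm_inj).
by [].
Qed.

(** Double counting: an injective map sends [b] to exactly one pair. *)
Lemma card_through_bin b e : (#|through b e| * 'C(n, 2) = n ^_ m)%N.
Proof.
rewrite mulnC -card_pairT -sum_nat_const.
rewrite (eq_bigr (fun f => #|through b f|)) => [|f _]; last first.
  by apply/eqP; rewrite eqn_leq !card_through_le.
rewrite -[n in RHS](card_ord n) -[m in RHS](card_ord m) -card_inj_ffuns -sum1_card.
rewrite (eq_bigr (fun f => \sum_(sigma : map | through b f sigma) 1)%N) => [|f _]; last first.
  by rewrite sum1_card.
rewrite (exchange_big_dep (fun sigma : map => injectiveb sigma)) => [|f sigma _ /andP[]//] /=.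
rewrite [RHS](eq_bigl (fun sigma : map => injectiveb sigma)) => [|sigma]; last by rewrite inE.
by apply: eq_bigr => sigma inj; rewrite (big_pred1 (im sigma b)) // => f; rewrite /through inj /= eq_sym.
Qed.

Lemma pattern_size b : (2 <= m)%N.
Proof. by apply: leq_trans (ltn_ord (sval b).2); rewrite ltnS (leq_ltn_trans (leq0n _) (pair_lt b)). Qed.

Lemma target_size : (2 <= n)%N.
Proof. by apply: leq_trans (ltn_ord (sval d0).2); rewrite ltnS (leq_ltn_trans (leq0n _) (pair_lt d0)). Qed.

Lemma card_through b e : #|through b e| = (2 * (n - 2) ^_ (m - 2))%N.
Proof.
have bin_gt0 : (0 < 'C(n, 2))%N by rewrite bin_gt0 target_size.
apply/eqP; rewrite -(eqn_pmul2r bin_gt0) card_through_bin; apply/eqP.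
have := pattern_size b; have := target_size; have := bin_ffact n 2.
case: (n) => [|[|k]] //; case: (m) => [|[|l]] // bin _ _.
rewrite !ffactnS /= !subSS !subn0 mulnA [(2 * _)%N]mulnC -[RHS]mulnA [(2 * _)%N]mulnC.
rewrite -[2%N]/(2`!) bin !ffactnS ffactn0 /= muln1.
by rewrite mulnC.
Qed.

End Patterns.

(** A product of k factors, each at least 1 - (k + 2) / n; truncated subtraction can only raise a
    factor. *)
Lemma ffact_ratio n k : (0 < n)%N ->
  1 - INR k * INR (k + 2) / INR n <= INR ((n - 2) ^_ k) / INR n ^ k <= 1.
Proof.
move=> n_gt0; have N0 : 0 < INR n by apply: (lt_INR 0); apply/ltP.
have iN : 0 < / INR n by apply: Rinv_0_lt_compat.
elim: k => [|k [IHl IHu]]; first by rewrite ffactn0 /= /Rdiv Rmult_0_l; lra.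
have pk : 0 < INR n ^ k by apply: pow_lt.
have r_ge0 : 0 <= INR ((n - 2) ^_ k) / INR n ^ k.
  by apply: Rmult_le_pos; [apply: pos_INR | apply/Rlt_le/Rinv_0_lt_compat].
have -> : INR ((n - 2) ^_ k.+1) / INR n ^ k.+1 =
    (INR ((n - 2) ^_ k) / INR n ^ k) * (INR (n - 2 - k) / INR n).
  by rewrite ffactnSr mult_INR -(tech_pow_Rmult _ k); field; lra.
move: (INR (_ ^_ _) / _) r_ge0 IHl IHu => r r_ge0 IHl IHu.
have le_n : INR (n - 2 - k) <= INR n by apply/le_INR/leP; rewrite -subnDA leq_subr.
have ge_n : INR n - INR (k + 2) <= INR (n - 2 - k).
  have : INR n <= INR (n - 2 - k + (k + 2)).
    by apply/le_INR/leP; rewrite -subnDA [(2 + k)%N]addnC addnC -leq_subLR.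
  by rewrite plus_INR; lra.
have u0 : 0 <= INR (n - 2 - k) by apply: pos_INR.
rewrite S_INR addSn S_INR; move: (INR (k + 2)) (INR (n - 2 - k)) (pos_INR k) IHl le_n ge_n u0.
rewrite /Rdiv; move: (INR k) => K K2 u K0 IHl le_n ge_n u0.
have ui : u * / INR n <= 1 by rewrite -(Rinv_r (INR n)); [apply: Rmult_le_compat_r; lra | lra].
have ul : 1 - K2 * / INR n <= u * / INR n.
  have := Rmult_le_compat_r _ _ _ (Rlt_le _ _ iN) ge_n.
  by rewrite Rmult_minus_distr_r Rinv_r; lra.
have u0' : 0 <= u * / INR n by apply: Rmult_le_pos; lra.
move: (u * _) ui ul u0' => v v1 v2 v0; split; last by nra.
have : 0 <= (K + 1) * / INR n by apply: Rmult_le_pos; lra.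
by nra.
Qed.

Lemma INR_expn n k : INR (expn n k) = INR n ^ k.
Proof. by elim: k => // k IHk; rewrite expnS mult_INR IHk. Qed.

Section PatternConcentration.
Variables (n m : nat) (d0 : pairT n).
Implicit Types (a b : pairT m) (S : {set pairT m}) (e f : pairT n).

Lemma size_gt1 : 2 <= INR n.
Proof. by apply: (le_INR 2); apply/leP; apply: target_size d0. Qed.

Lemma density_bound b e :
  2 - 2 * INR m ^ 2 / INR n <= density d0 b e <= 2.
Proof.
have n2 := size_gt1; have n_gt0 : (0 < n)%N by apply: ltnW; apply: target_size d0.
have -> : density d0 b e = 2 * (INR ((n - 2) ^_ (m - 2)) / INR n ^ (m - 2)).
  rewrite /density card_through mult_INR /=; field; apply: pow_nonzero; lra.
have [l u] := ffact_ratio (m - 2) n_gt0; split; last by lra.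
have : INR (m - 2) * INR (m - 2 + 2) <= INR m ^ 2.
  rewrite /= Rmult_1_r subnK ?(pattern_size b) //.
  by apply: Rmult_le_compat_r; [apply: pos_INR | apply/le_INR/leP; rewrite leq_subr].
have iN : 0 < / INR n by apply: Rinv_0_lt_compat; lra.
by move: l; rewrite /Rdiv; nra.
Qed.

(** Since [b] is not in [S], every edge counted differs from [b], and prescribing two different
    pairs instead of one saves a factor of order n. *)
Lemma influence_bound S b e f : b \notin S -> influence d0 S b e f <= 8 * INR #|S| / INR n.
Proof.
move=> bS; have n2 := size_gt1.
have [S0|[a0 a0S]] : S = set0 \/ exists a, a \in S.
  by case: (set_0Vmem S) => [->|[a aS]]; [left | right; exists a].
  by rewrite /influence S0 big_set0 cards0 /= /Rdiv; lra.
(* With m = 2 there is only one pair, so [S] would be empty; this keeps m - 3 from truncating. *)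
have m3 : (3 <= m)%N.
  rewrite ltn_neqAle (pattern_size b) andbT; apply: contraNneq bS => m2.
  by rewrite (pairT2_unique b a0 (esym m2)).
rewrite /influence.
have -> : 8 * INR #|S| / INR n = / INR n ^ (m - 2) * (\rsum_(a in S) (8 * INR n ^ (m - 3))).
  rewrite rsum_const_mem; have -> : (m - 2 = (m - 3).+1)%N by rewrite -subSn.
  by rewrite -(tech_pow_Rmult _ (m - 3)); field; split; [apply: pow_nonzero | ]; lra.
apply: Rmult_le_compat_l; first exact: (scale_ge0 m d0).
apply: rsum_le => a aS; have ne : a != b by apply: contraNneq bS => <-.
apply: Rle_trans (le_INR _ _ (leP (card_two_pairs d0 e f ne))) _.
have e8 : INR 2 ^ 3 = 8 by rewrite /=; ring.
by rewrite mult_INR !INR_expn e8; apply: Rle_refl.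
Qed.

(** [concentration] with [lam] equal to kappa n. The squared influences sum to at most (8 M / n)(2
    M) = v, so the exponent is kappa n (32 kappa M^2 - x), and the assumption on [x] leaves at least
    half of the gain. *)
Lemma stat_concentration q S b e c (M kappa x : R) (B : pred (graph n)) :
  0 <= q <= 1 -> c = 1 \/ c = -1 -> b \notin S ->
  1 <= M -> INR #|S| <= M -> 0 < kappa -> 64 * kappa * M ^ 2 <= x -> 64 * kappa * M ^ 2 <= 1 ->
  (forall X, B X -> x <= c * (stat d0 S b e X - bern q (stat d0 S b e))) ->
  bern q (fun X => ind (B X)) <= exp (- (kappa * x / 2) * INR n).
Proof.
move=> q01 c1 bS M1 SM k0 kx k1 Bx; have n2 := size_gt1.
have iN : 0 < / INR n by apply: Rinv_0_lt_compat; lra.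
have S0 := pos_INR #|S|.
pose F X := c * stat d0 S b e X + 0 * 0.
have bF : bern q F = c * bern q (stat d0 S b e).
  by rewrite /F (bern_lin q _ (fun=> 0)) bern_const; ring.
pose v := 16 * M ^ 2 / INR n.
have inf_ge0 f : 0 <= influence d0 S b e f.
  by have := dif_stat_bound d0 S b e f set0; lra.
apply: Rle_trans (_ : exp (2 * (kappa * INR n) ^ 2 * v - (kappa * INR n) * x) <= _).
  apply: (concentration q01 (F := F) (c := influence d0 S b e)) => [|f Y|f||Y /Bx]; last by rewrite bF /F; lra.
  - by apply: Rmult_le_pos; lra.
  - have -> : dif f F Y = c * dif f (stat d0 S b e) Y by rewrite /dif /F; ring.
    have := dif_stat_bound d0 S b e f Y; rewrite Rabs_mult.
    by move=> [? ?]; rewrite (Rabs_pos_eq (dif _ _ _)) //; case: c1 => ->; rewrite ?Rabs_R1 ?Rabs_Ropp ?Rabs_R1; lra.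
  - have le1 : kappa * INR n * influence d0 S b e f <= kappa * INR n * (8 * INR #|S| / INR n).
      by apply: Rmult_le_compat_l; [apply: Rmult_le_pos; lra | apply: influence_bound].
    have : kappa * INR n * (8 * INR #|S| / INR n) = 8 * kappa * INR #|S| by field; lra.
    by nra.
  - apply: Rle_trans (_ : \rsum_(f : pairT n) (8 * M / INR n * influence d0 S b e f) <= _).
      apply: rsum_le => f _; rewrite -[_ ^ 2]/(_ * (_ * 1)) Rmult_1_r.
      apply: Rmult_le_compat_r => //; apply: Rle_trans (influence_bound e f bS) _.
      by apply: Rmult_le_compat_r; lra.
    rewrite -rsum_distrr influence_sum.
    have [d_lo d_hi] := density_bound b e.
    have Sd : INR #|S| * density d0 b e <= 2 * M.
      have d_ge0 : 0 <= density d0 b e by have := stat_bound d0 S b e set0; lra.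
      by nra.
    have -> : v = 8 * M / INR n * (2 * M) by rewrite /v /Rdiv; ring.
    by apply: Rmult_le_compat_l => //; apply: Rmult_le_pos; lra.
have -> : 2 * (kappa * INR n) ^ 2 * v - kappa * INR n * x
  = - (kappa * x / 2) * INR n - kappa * INR n * (x / 2 - 32 * kappa * M ^ 2).
  by rewrite /v; field; lra.
set u := kappa * INR n * _; have u0 : 0 <= u by rewrite /u; apply: Rmult_le_pos; nra.
case: (Req_dec u 0) => [->|ne]; first by rewrite Rminus_0_r; apply: Rle_refl.
by apply/Rlt_le/exp_increasing; lra.
Qed.

End PatternConcentration.

Lemma adjE n (d0 : pairT n) (X : graph n) x y : x != y -> adj X x y = (mkpair d0 x y \in X).
Proof.
move=> ne; apply/existsP/idP => [[e /andP[eX]]|inX].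
  by rewrite -/(joins e x y) (joinsE d0) // => /eqP->.
by exists (mkpair d0 x y); rewrite inX -/(joins _ x y) joins_mkpair.
Qed.

Lemma NcountE n m (d0 : pairT n) (S : {set pairT m}) (X : graph n) :
  INR (Ncount S X) =
  \rsum_(sigma : {ffun 'I_m -> 'I_n} | injectiveb sigma) subind (im d0 sigma @: S) X.
Proof.
rewrite /Ncount card_rsum; apply: eq_bigr => sigma inj; congr ind.
apply/forallP/subsetP => [all_adj _ /imsetP[a aS ->]|sub a].
  by have := implyP (all_adj a) aS; rewrite (adjE d0) // map_neq.
by apply/implyP => aS; rewrite (adjE d0) ?map_neq //; apply/sub/(imset_f (im d0 sigma) aS).
Qed.

Lemma dif_Ncount n m (d0 : pairT n) (S : {set pairT m}) e (X : graph n) :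
  / INR n ^ (m - 2) * (INR (Ncount S (e |: X)) - INR (Ncount S (X :\ e))) =
  \rsum_(b in S) stat d0 (S :\ b) b e X.
Proof.
rewrite /stat -rsum_distrr !(NcountE d0) -rsum_sub; congr (_ * _).
rewrite (eq_bigr (fun sigma : {ffun 'I_m -> 'I_n} => \rsum_(b in S)
  (ind (im d0 sigma b == e) * subind (im d0 sigma @: (S :\ b)) X))) => [|sigma inj]; last first.
  exact: (dif_subind_imset S e X (@im_inj _ _ d0 _ inj)).
by rewrite exchange_big; apply: eq_bigr => b _; rewrite /through rsum_andb.
Qed.

(** Summing over [e] frees the image of [b], so the copies can be rooted instead at the edge [a]
    that is sent to [f]. The total effect of flipping [f] is thus read off from counts through
    [f]. *)
Lemma sum_dif_stat n m (d0 : pairT n) (S : {set pairT m}) b f (X : graph n) :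
  \rsum_(e : pairT n) dif f (stat d0 S b e) X = \rsum_(a in S) stat d0 (S :\ a) a f X.
Proof.
rewrite (eq_bigr (fun e => / INR n ^ (m - 2) * (\rsum_(sigma : {ffun 'I_m -> 'I_n} | injectiveb sigma)
  (ind (e == im d0 sigma b) *
   \rsum_(a in S) (ind (im d0 sigma a == f) * subind (im d0 sigma @: (S :\ a)) X))))) => [|e _]; last first.
  rewrite dif_stat /through rsum_andb; congr (_ * _).
  by apply: eq_bigr => sigma _; rewrite eq_sym.
rewrite /stat -!rsum_distrr exchange_big /=; congr (_ * _).
rewrite (eq_bigr (fun sigma : {ffun 'I_m -> 'I_n} => \rsum_(a in S)
  (ind (im d0 sigma a == f) * subind (im d0 sigma @: (S :\ a)) X))) => [|sigma _]; last first.
  exact: (rsum_eqop (im d0 sigma b) (fun=> \rsum_(a in S)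
    (ind (im d0 sigma a == f) * subind (im d0 sigma @: (S :\ a)) X))).
by rewrite exchange_big; apply: eq_bigr => a _; rewrite /through rsum_andb.
Qed.

(** * The logistic function *)

Section Expit.

Definition expit x := exp x / (1 + exp x).

Lemma expit01 x : 0 < expit x < 1.
Proof.
have p := exp_pos x; rewrite /expit; split.
  by apply: Rdiv_lt_0_compat; lra.
by apply: (Rmult_lt_reg_r (1 + exp x)); [lra | rewrite /Rdiv Rmult_assoc Rinv_l; lra].
Qed.

Lemma derivable_expit x : derivable_pt_lim expit x (expit x * (1 - expit x)).
Proof.
have p := exp_pos x.
have -> : expit x * (1 - expit x) = (exp x * (1 + exp x) - (0 + exp x) * exp x) / Rsqr (1 + exp x).
  by rewrite /expit /Rsqr; field; lra.
apply: (derivable_pt_lim_div exp (fun y => 1 + exp y)); last by lra.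
  exact: derivable_pt_lim_exp.
apply: (derivable_pt_lim_plus (fct_cte 1) exp); first exact: derivable_pt_lim_const.
exact: derivable_pt_lim_exp.
Qed.

Lemma expit_mvt x y (L : R) : x <= y ->
  (forall z, x <= z <= y -> expit z * (1 - expit z) <= L) ->
  0 <= expit y - expit x <= L * (y - x).
Proof.
case=> [lt_xy|<-] bnd; last by lra.
have [z [-> [? ?]]] := MVT_cor2 expit (fun z => expit z * (1 - expit z)) x y lt_xy
  (fun z _ => derivable_expit z).
have := bnd z; have := expit01 z => h1 h2; split; first by apply: Rmult_le_pos; nra.
by apply: Rmult_le_compat_r; [lra | apply: h2; lra].
Qed.

Lemma expit_lip x y : x <= y -> 0 <= expit y - expit x <= y - x.
Proof.
move=> le_xy; have := @expit_mvt x y 1 le_xy; rewrite Rmult_1_l; apply=> z _.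
by have := expit01 z; nra.
Qed.

(** The slope u (1 - u) at u = expit z is 1-Lipschitz in z, so on this interval it exceeds its value
    at [p] by at most [r]. *)
Lemma expit_local p r x y : x <= y -> p - r <= x -> y <= p + r ->
  0 <= expit y - expit x <= (expit p * (1 - expit p) + r) * (y - x).
Proof.
move=> le_xy px py; apply: expit_mvt => // z [xz zy].
have ez := expit01 z; have ep := expit01 p.
have [le_zp|le_pz] := Rle_lt_dec z p.
  by have := expit_lip le_zp; nra.
by have := expit_lip (Rlt_le _ _ le_pz); nra.
Qed.

End Expit.

Definition leR (x y : R) : bool := if Rle_dec x y then true else false.

Lemma leRP x y : reflect (x <= y) (leR x y).
Proof. by rewrite /leR; case: Rle_dec => h; constructor. Qed.

Lemma pow_close k p q : 0 <= p <= 1 -> 0 <= q <= 1 -> Rabs (p ^ k - q ^ k) <= INR k * Rabs (p - q).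
Proof.
move=> p01 q01; elim: k => [|k IHk]; first by rewrite /= Rminus_diag Rabs_R0; lra.
rewrite S_INR -!(tech_pow_Rmult _ k).
have -> : p * p ^ k - q * q ^ k = p * (p ^ k - q ^ k) + q ^ k * (p - q) by ring.
apply: Rle_trans (Rabs_triang _ _) _; rewrite !Rabs_mult (Rabs_pos_eq p) ?(Rabs_pos_eq (q ^ k)); try lra.
  have qk : q ^ k <= 1 by rewrite -(pow1 k); apply: pow_incr.
  by have := Rabs_pos (p ^ k - q ^ k); have := Rabs_pos (p - q); nra.
by apply: pow_le; lra.
Qed.

(** * Update rates of the exponential random graph *)

Section Model.
Variables (s : nat) (m : 'I_s -> nat) (E : forall i : 'I_s, {set pairT (m i)}) (beta : 'I_s -> R).
Hypothesis first_edge : forall i : 'I_s, nat_of_ord i = 0%N -> m i = 2%N.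
Hypothesis beta_pos : forall i : 'I_s, (0 < i)%N -> 0 < beta i.

(** Only the single-edge term may have a negative coefficient, and it adds a constant to [dH]; in
    all other terms the sign is available. *)
Lemma beta_cases i : 0 <= beta i \/ m i = 2%N.
Proof.
case: (posnP i) => [i0|i0]; first by right; apply: first_edge.
by left; apply/Rlt_le/beta_pos.
Qed.

Lemma single_edge i (S : {set pairT (m i)}) b : m i = 2%N -> S :\ b = set0.
Proof. by move=> m2; apply/setP=> a; rewrite !inE (pairT2_unique a b m2) eqxx. Qed.

Definition edge_rate n (e : pairT n) (X : graph n) : R := expit (dH E beta X e).

(** Derivative of [Psi], arranged over ordered pairs of distinct edges to match [sum_dif_dH], with 2
    q^k in place of the counts. *)
Definition Psi' q := \rsum_(i : 'I_s) (beta i *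
  \rsum_(b in E i) \rsum_(a in E i :\ b) (2 * q ^ #|E i :\ b :\ a|)).

(** An error [eps] in every count moves [dH] by at most [weight1 * eps] and its summed differences
    at a pair by at most [weight2 * eps]. *)
Definition weight1 := \rsum_(i : 'I_s) (Rabs (beta i) * INR #|E i|).
Definition weight2 := \rsum_(i : 'I_s) (Rabs (beta i) * (INR #|E i| * INR #|E i|)).

Lemma weight1_ge0 : 0 <= weight1.
Proof. by apply: rsum_ge0 => i _; apply: Rmult_le_pos; [apply: Rabs_pos | apply: pos_INR]. Qed.

Lemma weight2_ge0 : 0 <= weight2.
Proof.
apply: rsum_ge0 => i _; apply: Rmult_le_pos; first exact: Rabs_pos.
by apply: Rmult_le_pos; apply: pos_INR.
Qed.

Lemma Psi_stat q : Psi E beta q = \rsum_(i : 'I_s) (beta i * \rsum_(b in E i) (2 * q ^ #|E i :\ b|)).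
Proof.
rewrite /Psi sumRE; apply: eq_bigr => i _.
rewrite (eq_bigr (fun=> 2 * q ^ (#|E i| - 1))) => [|b bE]; last by rewrite [#|E i|](cardsD1 b) bE addKn.
by rewrite rsum_const_mem; ring.
Qed.

Lemma derivable_Psi q : derivable_pt_lim (Psi E beta) q (Psi' q).
Proof.
pose F (i : 'I_s) x := 2 * beta i * INR #|E i| * x ^ (#|E i| - 1).
pose F' (i : 'I_s) := 2 * beta i * INR #|E i| * (INR (#|E i| - 1) * q ^ (#|E i| - 1).-1).
have dF i : derivable_pt_lim (F i) q (F' i).
  by apply: (derivable_pt_lim_scal (fun x => x ^ (#|E i| - 1))); apply: derivable_pt_lim_pow.
have -> : Psi' q = foldr (fun i acc => F' i + acc) 0 (enum 'I_s).
  rewrite -/(sumR F') sumRE; apply: eq_bigr => i _; rewrite /F'.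
  rewrite (eq_bigr (fun=> INR (#|E i| - 1) * (2 * q ^ (#|E i| - 1).-1))) => [|b bE].
    by rewrite rsum_const_mem; ring.
  have cb : (#|E i| - 1 = #|E i :\ b|)%N by rewrite (cardsD1 b) bE addKn.
  rewrite (eq_bigr (fun=> 2 * q ^ (#|E i| - 1).-1)) => [|a aE].
    by rewrite rsum_const_mem cb.
  by rewrite cb [in RHS](cardsD1 a) aE.
change (Psi E beta) with (fun x => foldr (fun i acc => F i x + acc) 0 (enum 'I_s)).
elim: (enum 'I_s) => [|i l IHl] /=; first exact: derivable_pt_lim_const.
exact: (derivable_pt_lim_plus (F i) _ _ _ _ (dF i) IHl).
Qed.

(** Rooted patterns (i, b, S). Their number does not depend on n, so a union bound over patterns and
    pairs costs only order n^2. *)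
Definition patterns : finType := {i : 'I_s & (pairT (m i) * {set pairT (m i)})%type}.

Section Size.
Variables (n : nat) (d0 : pairT n).
Implicit Types (e f : pairT n) (X Y : graph n).

Lemma dH_stat X e : dH E beta X e =
  \rsum_(i : 'I_s) (beta i * \rsum_(b in E i) stat d0 (E i :\ b) b e X).
Proof.
rewrite /dH /Ham !sumRE -rsum_sub; apply: eq_bigr => i _.
by rewrite -dif_Ncount /Rdiv; ring.
Qed.

Lemma dif_dH f e X : dif f (fun Y => dH E beta Y e) X =
  \rsum_(i : 'I_s) (beta i * \rsum_(b in E i) dif f (stat d0 (E i :\ b) b e) X).
Proof.
rewrite /dif !dH_stat -rsum_sub; apply: eq_bigr => i _.
by rewrite -Rmult_minus_distr_l -rsum_sub.
Qed.

Lemma dif_dH_ge0 f e X : 0 <= dif f (fun Y => dH E beta Y e) X.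
Proof.
rewrite dif_dH; apply: rsum_ge0 => i _; have [b0|m2] := beta_cases i.
  apply: Rmult_le_pos => //; apply: rsum_ge0 => b _.
  exact: (dif_stat_bound d0 (E i :\ b) b e f X).1.
rewrite big1 ?Rmult_0_r; first exact: Rle_refl.
by move=> b _; rewrite /dif (single_edge _ _ m2) !stat_set0 Rminus_diag.
Qed.

Lemma sum_dif_dH f X : \rsum_(e : pairT n) dif f (fun Y => dH E beta Y e) X =
  \rsum_(i : 'I_s) (beta i * \rsum_(b in E i) \rsum_(a in E i :\ b) stat d0 (E i :\ b :\ a) a f X).
Proof.
rewrite (eq_bigr _ (fun e _ => dif_dH f e X)) exchange_big /=; apply: eq_bigr => i _.
rewrite -rsum_distrr exchange_big /=; congr (_ * _); apply: eq_bigr => b _.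
exact: sum_dif_stat.
Qed.

(** For c = 1 some count is too large, for c = -1 too small. Separating the signs makes each event
    monotone. *)
Definition bad c q eps X : bool := [exists jf : patterns * pairT n,
  ((tagged jf.1).1 \notin (tagged jf.1).2) &&
  leR eps (c * (stat d0 (tagged jf.1).2 (tagged jf.1).1 jf.2 X - 2 * q ^ #|(tagged jf.1).2|))].

Lemma not_bad c q eps X i (b : pairT (m i)) (S : {set pairT (m i)}) f : ~~ bad c q eps X ->
  b \notin S -> c * (stat d0 S b f X - 2 * q ^ #|S|) <= eps.
Proof.
move=> ok bS; apply: Rnot_lt_le => /Rlt_le/leRP le_eps; case/existsP: ok.
exists (Tagged (fun i => (pairT (m i) * {set pairT (m i)})%type) (b, S), f) => /=.
by rewrite bS.
Qed.

Lemma bad_mono c q eps X Y : c = 1 /\ X \subset Y \/ c = -1 /\ Y \subset X ->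
  bad c q eps X -> bad c q eps Y.
Proof.
move=> cXY /existsP[jf /andP[ok /leRP le_eps]]; apply/existsP; exists jf; rewrite ok /=.
apply/leRP; apply: Rle_trans le_eps _.
have up (x y z : R) : x <= y -> 1 * (x - z) <= 1 * (y - z) by lra.
have down (x y z : R) : y <= x -> -1 * (x - z) <= -1 * (y - z) by lra.
by case: cXY => -[-> sub]; [apply: up | apply: down]; apply: stat_inc.
Qed.

Lemma density_edge i (b : pairT (m i)) e : m i = 2%N -> density d0 b e = 2.
Proof. by move=> m2; rewrite /density card_through m2 subnn ffactn0 /=; field. Qed.

Lemma good_dH c q eps X e : c = 1 \/ c = -1 -> 0 <= eps -> ~~ bad c q eps X ->
  c * (dH E beta X e - Psi E beta q) <= weight1 * eps.
Proof.
move=> c1 eps0 ok; rewrite dH_stat Psi_stat -rsum_sub rsum_distrr /weight1.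
rewrite [_ * eps]Rmult_comm rsum_distrr; apply: rsum_le => i _.
rewrite -Rmult_minus_distr_l -rsum_sub; have [b0|m2] := beta_cases i.
  have le_eps : c * (\rsum_(b in E i) (stat d0 (E i :\ b) b e X - 2 * q ^ #|E i :\ b|)) <= INR #|E i| * eps.
    by rewrite rsum_distrr -rsum_const_mem; apply: rsum_le => b _; apply: not_bad ok _; rewrite !inE eqxx.
  by rewrite (Rabs_pos_eq (beta i)) //; nra.
rewrite big1 => [|b _].
  by have := Rabs_pos (beta i); have := pos_INR #|E i|; rewrite !Rmult_0_r => ? ?; do 2!apply: Rmult_le_pos => //.
by rewrite (single_edge _ _ m2) stat_set0 density_edge // cards0 /=; ring.
Qed.

Lemma good_sum_dH q eps X f : 0 <= eps -> ~~ bad 1 q eps X ->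
  \rsum_(e : pairT n) dif f (fun Y => dH E beta Y e) X <= Psi' q + weight2 * eps.
Proof.
move=> eps0 ok; rewrite sum_dif_dH.
suff : \rsum_(i : 'I_s) (beta i * \rsum_(b in E i) \rsum_(a in E i :\ b) stat d0 (E i :\ b :\ a) a f X)
  - Psi' q <= weight2 * eps by lra.
rewrite /Psi' -rsum_sub /weight2 [_ * eps]Rmult_comm rsum_distrr; apply: rsum_le => i _.
have [E0 E2] := (pos_INR #|E i|, Rmult_le_pos _ _ (pos_INR #|E i|) (pos_INR #|E i|)).
rewrite -Rmult_minus_distr_l -rsum_sub; have [b0|m2] := beta_cases i; last first.
  rewrite big1 => [|b _]; last by rewrite (single_edge _ _ m2) !big_set0 Rminus_diag.
  by have := Rabs_pos (beta i); rewrite Rmult_0_r => ?; do 2!apply: Rmult_le_pos => //.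
have le_eps : \rsum_(b in E i) (\rsum_(a in E i :\ b) stat d0 (E i :\ b :\ a) a f X
     - \rsum_(a in E i :\ b) (2 * q ^ #|E i :\ b :\ a|)) <= INR #|E i| * (INR #|E i| * eps).
  rewrite -rsum_const_mem; apply: rsum_le => b _; rewrite -rsum_sub.
  apply: Rle_trans (_ : INR #|E i :\ b| * eps <= _); last first.
    by apply: Rmult_le_compat_r => //; apply/le_INR/leP/subset_leq_card/subD1set.
  rewrite -rsum_const_mem; apply: rsum_le => a _.
  by rewrite -[X in X <= _]Rmult_1_l; apply: not_bad ok _; rewrite !inE eqxx.
by rewrite (Rabs_pos_eq (beta i)) //; nra.
Qed.

Lemma sum_dif_dH_bound X f :
  \rsum_(e : pairT n) dif f (fun Y => dH E beta Y e) X <= weight2 * 2.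
Proof.
rewrite sum_dif_dH /weight2 [_ * 2]Rmult_comm rsum_distrr; apply: rsum_le => i _.
have [E0 E2] := (pos_INR #|E i|, Rmult_le_pos _ _ (pos_INR #|E i|) (pos_INR #|E i|)).
have [b0|m2] := beta_cases i; last first.
  rewrite big1 => [|b _]; last by rewrite (single_edge _ _ m2) !big_set0.
  by have := Rabs_pos (beta i); rewrite Rmult_0_r => ?; apply: Rmult_le_pos; [lra | apply: Rmult_le_pos].
have le2 : \rsum_(b in E i) (\rsum_(a in E i :\ b) stat d0 (E i :\ b :\ a) a f X)
     <= INR #|E i| * (INR #|E i| * 2).
  rewrite -rsum_const_mem; apply: rsum_le => b _.
  apply: Rle_trans (_ : INR #|E i :\ b| * 2 <= _); last first.
    by apply: Rmult_le_compat_r; [lra | apply/le_INR/leP/subset_leq_card/subD1set].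
  rewrite -rsum_const_mem; apply: rsum_le => a _.
  have [_ hs] := stat_bound d0 (E i :\ b :\ a) a f X; have [_ hd] := density_bound d0 a f.
  by lra.
by rewrite (Rabs_pos_eq (beta i)) //; nra.
Qed.

Lemma rate_rates : rates (@edge_rate n).
Proof.
move=> e X; split; first by have := expit01 (dH E beta X e); rewrite /edge_rate; lra.
by rewrite /edge_rate /dH setU1U1 setD1U1 setU1D1 setD1D1.
Qed.

Lemma rate_inc e : inc (edge_rate e).
Proof.
apply: inc_step => f X; have := dif_dH_ge0 f e X; rewrite /dif /edge_rate => d_ge0.
have := @expit_lip (dH E beta (X :\ f) e) (dH E beta (f |: X) e).
lra.
Qed.

Lemma dif_rate_bound f e X :
  0 <= dif f (edge_rate e) X <= dif f (fun Y => dH E beta Y e) X.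
Proof.
by have := dif_dH_ge0 f e X; rewrite /dif /edge_rate => d_ge0; apply: expit_lip; lra.
Qed.

Lemma sum_dif_rate_bound f X : \rsum_(e : pairT n) Rabs (dif f (edge_rate e) X) <= weight2 * 2.
Proof.
apply: Rle_trans (sum_dif_dH_bound X f); apply: rsum_le => e _.
by have [? ?] := dif_rate_bound f e X; rewrite Rabs_pos_eq.
Qed.

(** Goodness from above at [f |: X] and from below at [X :\ f] traps both values of [dH] near
    [Psi p], so the slope of [expit] between them is at most slightly above the one at [Psi p]. At
    [eps] = 0 the product is the derivative of [phi] at [p]. *)
Lemma good_contraction p eps delta f X : 0 <= eps ->
  (expit (Psi E beta p) * (1 - expit (Psi E beta p)) + weight1 * eps)
     * (Psi' p + weight2 * eps) <= 1 - delta ->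
  ~~ bad (-1) p eps (X :\ f) -> ~~ bad 1 p eps (f |: X) ->
  \rsum_(e : pairT n) dif f (edge_rate e) X <= 1 - delta.
Proof.
move=> eps0 le_delta lo hi; apply: Rle_trans le_delta.
have w1 := weight1_ge0; have l0 := expit01 (Psi E beta p).
set L := _ + weight1 * eps; have L0 : 0 <= L by rewrite /L; nra.
have hiX : ~~ bad 1 p eps X.
  by apply: contra hi; apply: bad_mono; left; split; rewrite ?subsetUr.
apply: Rle_trans (_ : L * (\rsum_(e : pairT n) dif f (fun Y => dH E beta Y e) X) <= _); last first.
  by apply: Rmult_le_compat_l => //; apply: good_sum_dH.
rewrite rsum_distrr; apply: rsum_le => e _.
have := dif_dH_ge0 f e X; rewrite /dif /edge_rate => d_ge0.
have := good_dH e (or_introl erefl) eps0 hi; have := good_dH e (or_intror erefl) eps0 lo => hlo hhi.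
have := @expit_local (Psi E beta p) (weight1 * eps) (dH E beta (X :\ f) e) (dH E beta (f |: X) e).
by rewrite -/L; lra.
Qed.

End Size.
End Model.

(** * Bootstrap of the stochastic domination *)

Section Asymptotics.

Lemma eventually_ge (a : R) : exists n0 : nat, forall n, (n0 <= n)%N -> a <= INR n.
Proof.
have [n0 an0] := INR_unbounded a; exists n0 => n /leP/le_INR; lra.
Qed.

Lemma exp_mul_nat k y : exp (INR k * y) = exp y ^ k.
Proof.
elim: k => [|k IHk]; first by rewrite /= Rmult_0_l exp_0.
by rewrite S_INR -(tech_pow_Rmult _ k) -IHk -exp_plus; congr exp; ring.
Qed.

Lemma exp_neg_bound kappa k : 0 < kappa ->
  exists2 D, 0 < D & forall x, 0 < x -> exp (- kappa * x) <= D / x ^ k.+1.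
Proof.
move=> k0; have K0 : 0 < INR k.+1 by apply: (lt_INR 0); apply/ltP.
have c0 : 0 < kappa / INR k.+1 by apply: Rdiv_lt_0_compat.
exists (/ (kappa / INR k.+1) ^ k.+1) => [|x x0]; first by apply/Rinv_0_lt_compat/pow_lt.
have -> : - kappa * x = - (INR k.+1 * (kappa / INR k.+1 * x)) by field; lra.
rewrite exp_Ropp [X in _ <= X]/Rdiv -Rinv_mult -Rpow_mult_distr; apply: Rinv_le_contravar.
  by apply/pow_lt/Rmult_lt_0_compat.
have y0 : 0 < kappa / INR k.+1 * x by apply: Rmult_lt_0_compat.
move: (kappa / INR k.+1 * x) y0 => y y0.
rewrite exp_mul_nat.
by apply: pow_incr; have := exp_ineq1_le y; lra.
Qed.

Lemma exp_small D kappa K : 0 < kappa -> exists n0 : nat, forall n, (n0 <= n)%N ->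
  D * INR n ^ 2 * exp (- kappa * INR n) <= / INR n ^ K.
Proof.
move=> k0; have [D' D'0 bnd] := exp_neg_bound (K + 2) k0.
have [n0 hn0] := eventually_ge (Rabs D * D' + 1); exists n0 => n /hn0 hn.
have n1 : 1 <= INR n by have := Rabs_pos D; nra.
have := bnd (INR n); have -> : INR n ^ (K + 2).+1 = INR n ^ K * (INR n ^ 2 * INR n).
  by rewrite -addn1 !pow_add pow_1; ring.
have p0 : 0 < INR n ^ K by apply: pow_lt; lra.
move: (INR n ^ K) p0 (exp _) (exp_pos (- kappa * INR n)) => p p0 e e0 /(_ _) he.
have {}he : e <= D' / (p * (INR n ^ 2 * INR n)) by apply: he; lra.
have n2 : 0 < INR n ^ 2 by apply: pow_lt; lra.
apply: Rle_trans (_ : Rabs D * INR n ^ 2 * (D' / (p * (INR n ^ 2 * INR n))) <= _).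
  apply: Rle_trans (_ : Rabs D * INR n ^ 2 * e <= _).
    apply: Rmult_le_compat_r; first lra; apply: Rmult_le_compat_r; [lra | exact: Rle_abs].
  by apply: Rmult_le_compat_l => //; apply: Rmult_le_pos; [apply: Rabs_pos | lra].
have -> : Rabs D * INR n ^ 2 * (D' / (p * (INR n ^ 2 * INR n))) = / p * (Rabs D * D' / INR n).
  by field; repeat split; lra.
rewrite -[X in _ <= X]Rmult_1_r; apply: Rmult_le_compat_l.
  by apply/Rlt_le/Rinv_0_lt_compat.
by apply: (Rmult_le_reg_r (INR n)); [lra | rewrite /Rdiv Rmult_assoc Rinv_l; lra].
Qed.

(** Common unit of time: the waiting times below are integer multiples of it. *)
Definition tau (n : nat) : nat := Z.to_nat (up (INR n ^ 2 * ln (INR n))).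

Lemma ln_ge0 n : (1 <= n)%N -> 0 <= ln (INR n).
Proof.
move=> /leP/(le_INR 1) /= n1; rewrite -ln_1; case: n1 => [lt|<-]; last exact: Rle_refl.
by apply/Rlt_le/ln_increasing; lra.
Qed.

Lemma tau_bounds n : (1 <= n)%N ->
  INR n ^ 2 * ln (INR n) <= INR (tau n) <= INR n ^ 2 * ln (INR n) + 1.
Proof.
move=> n1; have [up1 up2] := archimed (INR n ^ 2 * ln (INR n)).
have pos : 0 <= INR n ^ 2 * ln (INR n).
  by apply: Rmult_le_pos; [apply: pow2_ge_0 | apply: ln_ge0].
have up0 : (0 <= up (INR n ^ 2 * ln (INR n)))%Z by apply: le_IZR; lra.
by rewrite /tau (INR_IZR_INZ (Z.to_nat _)) Z2Nat.id //; lra.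
Qed.

Lemma tau_le_cube n : (1 <= n)%N -> INR (tau n) <= INR n ^ 3.
Proof.
move=> n1; have [_ ub] := tau_bounds n1; have nR : 1 <= INR n by apply: (le_INR 1); apply/leP.
have : ln (INR n) <= INR n - 1.
  by have := exp_ineq1_le (ln (INR n)); rewrite exp_ln; lra.
move: (ln _) ub => l ub lb.
have : INR n ^ 2 * l <= INR n ^ 2 * (INR n - 1) by apply: Rmult_le_compat_l => //; apply: pow2_ge_0.
by rewrite /= in ub *; nra.
Qed.

Lemma sites_bounds n : (2 <= n)%N ->
  INR n ^ 2 / 4 <= INR #|pairT n| <= INR n ^ 2 / 2.
Proof.
move=> n2; have nR : 2 <= INR n by apply: (le_INR 2); apply/leP.
have : (#|pairT n| * 2 = n * n.-1)%N.
  by have := bin_ffact n 2; rewrite card_pairT !ffactnS ffactn0 muln1.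
move/(congr1 INR); rewrite !mult_INR -subn1 minus_INR ?(INR_IZR_INZ 2) /=; last by apply/leP/ltnW.
by nra.
Qed.

Lemma pow_one_minus x t : 0 <= x <= 1 -> (1 - x) ^ t <= exp (- (INR t * x)).
Proof.
move=> x01; elim: t => [|t IHt]; first by rewrite /= Rmult_0_l Ropp_0 exp_0; lra.
rewrite S_INR -(tech_pow_Rmult _ t).
have -> : - ((INR t + 1) * x) = - x + - (INR t * x) by ring.
rewrite exp_plus; apply: Rmult_le_compat => //; [lra | by apply: pow_le; lra |].
by have := exp_ineq1_le (- x); lra.
Qed.

(** As N <= n^2 / 2, a unit of time contains at least 2 ln n rounds of N steps. *)
Lemma pow_tau n k delta : (2 <= n)%N -> 0 <= delta <= 1 ->
  (1 - delta / INR #|pairT n|) ^ (k * tau n) <= exp (- (2 * INR k * delta * ln (INR n))).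
Proof.
move=> n2 d01; have [lo hi] := sites_bounds n2; have n1 := ltnW n2.
have nR : 2 <= INR n by apply: (le_INR 2); apply/leP.
have N1 : 1 <= INR #|pairT n| by nra.
have iN : 0 < / INR #|pairT n| <= 1.
  by split; [apply: Rinv_0_lt_compat; lra | rewrite -Rinv_1; apply: Rinv_le_contravar; lra].
apply: Rle_trans (pow_one_minus _ _) _; first by rewrite /Rdiv; nra.
have [tl _] := tau_bounds n1; have l0 := ln_ge0 n1.
have le : 2 * ln (INR n) <= INR (tau n) / INR #|pairT n|.
  apply: (Rmult_le_reg_r (INR #|pairT n|)); first lra.
  by rewrite /Rdiv [X in _ <= X]Rmult_assoc Rinv_l; nra.
have {}le : - (INR (k * tau n) * (delta / INR #|pairT n|)) <= - (2 * INR k * delta * ln (INR n)).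
  apply: Ropp_le_contravar; rewrite mult_INR.
  have -> : INR k * INR (tau n) * (delta / INR #|pairT n|) =
    (INR k * delta) * (INR (tau n) / INR #|pairT n|) by rewrite /Rdiv; ring.
  have kd : 0 <= INR k * delta by apply: Rmult_le_pos; [apply: pos_INR | lra].
  by have := Rmult_le_compat_l _ _ _ kd le; lra.
by case: le => [lt|->]; [apply/Rlt_le/exp_increasing | apply: Rle_refl].
Qed.

End Asymptotics.

Lemma ind_exists (I : finType) (P : pred I) : ind [exists i, P i] <= \rsum_(i : I) ind (P i).
Proof.
have ge0 i : true -> 0 <= ind (P i) by move=> _; have := ind_bound (P i); lra.
have [/existsP[i Pi]|_] /= := boolP [exists i, P i]; last exact: rsum_ge0.
by have := rsum_term_le (j := i) isT ge0; rewrite Pi.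
Qed.

Section Domination.
Variables (s : nat) (m : 'I_s -> nat) (E : forall i : 'I_s, {set pairT (m i)}) (beta : 'I_s -> R).
Hypothesis first_edge : forall i : 'I_s, nat_of_ord i = 0%N -> m i = 2%N.
Hypothesis beta_pos : forall i : 'I_s, (0 < i)%N -> 0 < beta i.
Notation Psi := (Psi E beta).
Notation rate := (edge_rate E beta).
Notation phi := (phi E beta).

Lemma pairT_exists n : (2 <= n)%N -> {d0 : pairT n | (0 < #|pairT n|)%N}.
Proof.
case: n => [|[|n]] // _.
have lt01 : ((ord0 : 'I_n.+2) < (inord 1 : 'I_n.+2))%N by rewrite inordK.
pose d0 : pairT n.+2 := exist (fun p : 'I_n.+2 * 'I_n.+2 => (p.1 < p.2)%N) (ord0, inord 1) lt01.
by exists d0; apply/card_gt0P; exists d0.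
Qed.

Lemma edge_bound : exists M, 1 <= M /\ forall i (S : {set pairT (m i)}), INR #|S| <= M.
Proof.
exists (1 + \rsum_(i : 'I_s) INR #|pairT (m i)|); split.
  suff : 0 <= \rsum_(i : 'I_s) INR #|pairT (m i)| by lra.
  by apply: rsum_ge0 => i _; apply: pos_INR.
move=> i S; apply: Rle_trans (_ : INR #|pairT (m i)| <= _); first by apply/le_INR/leP/max_card.
apply: Rle_trans (_ : \rsum_(j : 'I_s) INR #|pairT (m j)| <= _); last by lra.
by apply: (rsum_term_le (F := fun j => INR #|pairT (m j)|)) => // j _; apply: pos_INR.
Qed.

Lemma bern_bad q eps : 0 <= q <= 1 -> 0 < eps ->
  exists D kappa, 0 < kappa /\ exists n0 : nat, forall n (d0 : pairT n) c,
    (n0 <= n)%N -> c = 1 \/ c = -1 ->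
    bern q (fun X => ind (bad m d0 c q eps X)) <= D * INR n ^ 2 * exp (- kappa * INR n).
Proof.
move=> q01 eps0.
have [M [M1 M_ge]] := edge_bound.
pose mm := \rsum_(i : 'I_s) INR (m i).
have mm_ge i : INR (m i) <= mm.
  by apply: (rsum_term_le (F := fun i => INR (m i))) => // j _; apply: pos_INR.
have mm0 : 0 <= mm by apply: rsum_ge0 => i _; apply: pos_INR.
(* The other half of [eps] absorbs the distance of [density] from its limit 2. *)
pose x := eps / 2.
(* The largest rate allowed by both smallness conditions of [stat_concentration]. *)
pose k0 := Rmin x 1 / (64 * M ^ 2).
have M2 : 0 < 64 * M ^ 2 by nra.
have min0 : 0 < Rmin x 1 by apply: Rmin_glb_lt; rewrite /x; lra.
have k0_gt0 : 0 < k0 by apply: Rdiv_lt_0_compat.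
have k0E : 64 * k0 * M ^ 2 = Rmin x 1 by rewrite /k0; field; lra.
exists (INR #|patterns m|), (k0 * x / 2); split.
  by rewrite /x; apply: Rdiv_lt_0_compat; [apply: Rmult_lt_0_compat; lra | lra].
have [n0 hn0] := eventually_ge (4 * mm ^ 2 / eps).
exists n0 => n d0 c /hn0 n_large c1.
have n2 := size_gt1 d0; have [_ sites_le] := sites_bounds (target_size d0).
have small : 2 * mm ^ 2 / INR n <= x.
  apply: (Rmult_le_reg_r (INR n)); first lra.
  rewrite /Rdiv Rmult_assoc Rinv_l; last lra.
  rewrite /x; have : 4 * mm ^ 2 <= INR n * eps; last by lra.
  have := Rmult_le_compat_r _ _ _ (Rlt_le _ _ eps0) n_large.
  by rewrite /Rdiv Rmult_assoc Rinv_l; lra.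
pose P (jf : patterns m * pairT n) (X : graph n) := ((tagged jf.1).1 \notin (tagged jf.1).2) &&
  leR eps (c * (stat d0 (tagged jf.1).2 (tagged jf.1).1 jf.2 X - 2 * q ^ #|(tagged jf.1).2|)).
have le_each jf : bern q (fun X => ind (P jf X)) <= exp (- (k0 * x / 2) * INR n).
  case: jf => [[i [b S]] f]; rewrite /P /=.
  have [bS|bS] /= := boolP (b \in S).
    by rewrite bern_const //; apply/Rlt_le/exp_pos.
  apply: (stat_concentration (d0 := d0) (e := f) (M := M) q01 c1 bS) => //; rewrite ?k0E.
  - exact: Rmin_l.
  - exact: Rmin_r.
  - move=> X /leRP le_eps; rewrite (bern_stat d0).
    have [dl du] := density_bound d0 b f.
    have qS : 0 <= q ^ #|S| <= 1.
      by split; [apply: pow_le; lra | rewrite -(pow1 #|S|); apply: pow_incr].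
    have mi2 : INR (m i) ^ 2 <= mm ^ 2 by apply: pow_incr; split; [apply: pos_INR | apply: mm_ge].
    have iN : 0 < / INR n by apply: Rinv_0_lt_compat; lra.
    have dx : 2 - x <= density d0 b f.
      apply: Rle_trans dl; rewrite /Rdiv in small *.
      have : 2 * INR (m i) ^ 2 * / INR n <= 2 * mm ^ 2 * / INR n by apply: Rmult_le_compat_r; lra.
      by lra.
    move: le_eps; rewrite /x in dx *; move: (stat _ _ _ _ _) (density _ _ _) dx du (q ^ _) qS => a d dx du y y01.
    have : 2 * y - eps / 2 <= y * d <= 2 * y by nra.
    by case: c1 => ->; lra.
apply: Rle_trans (_ : bern q (fun X => \rsum_(jf : patterns m * pairT n) ind (P jf X)) <= _).
  by apply: bern_le => // X; apply: ind_exists.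
rewrite /bern prodE_sum; apply: Rle_trans (rsum_le (fun jf (_ : xpredT jf) => le_each jf)) _.
rewrite rsum_constT card_prod mult_INR; apply: Rmult_le_compat_r; first exact: Rlt_le (exp_pos _).
by apply: Rmult_le_compat_l; [apply: pos_INR | have := pow2_ge_0 (INR n); lra].
Qed.

Definition start (T : finType) (c : R) : {set T} := if leR 0 c then [set: T] else set0.

Lemma start1 T : start T 1 = setT.
Proof. by rewrite /start; case: leRP => //; lra. Qed.

Lemma startN1 T : start T (-1) = set0.
Proof. by rewrite /start; case: leRP => //; lra. Qed.

(* Stochastic domination, up to an arbitrarily small polynomial error and after
   [O(n^2 ln n)] steps: for [c = 1] of the chain started from the complete graph
   by Bernoulli(q), for [c = -1] of Bernoulli(q) by the chain started from the
   empty graph. *)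
Definition dominated (c q : R) := forall K : nat, exists A n0 : nat,
  forall n t (f : graph n -> R), (n0 <= n)%N -> (A * tau n <= t)%N -> inc f -> bounded01 f ->
  c * (evolve (@rate n) t f (start (pairT n) c) - bern q f) <= / INR n ^ K.

(** The bad event is increasing for c = 1; for c = -1 its complement is. Domination therefore
    carries the Bernoulli estimate over to the chain, and one power of n is spent on adding the two
    errors. *)
Lemma bad_unlikely_dominated c q eps K : c = 1 \/ c = -1 -> 0 <= q <= 1 -> 0 < eps ->
  dominated c q -> exists A n0 : nat, forall n t (d0 : pairT n), (n0 <= n)%N -> (A * tau n <= t)%N ->
  evolve (@rate n) t (fun X => ind (bad m d0 c q eps X)) (start (pairT n) c) <= / INR n ^ K.
Proof.
move=> c1 q01 eps0 /(_ K.+1)[A [n1 dom]].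
have [D [kappa [kappa0 [n2 hbern]]]] := bern_bad q01 eps0.
have [n3 hsmall] := exp_small D K.+1 kappa0.
exists A, (n1 + n2 + n3)%N => n t d0 n_large t_large.
have hn1 : (n1 <= n)%N by apply: leq_trans n_large; rewrite -addnA leq_addr.
have hn2 : (n2 <= n)%N by apply: leq_trans n_large; rewrite addnAC leq_addl.
have hn3 : (n3 <= n)%N by apply: leq_trans n_large; rewrite leq_addl.
have nR := size_gt1 d0; have T0 : (0 < #|pairT n|)%N by apply/card_gt0P; exists d0.
set B := fun X => ind _.
have B01 : bounded01 B by move=> X; apply: ind_bound.
have B_mono (X Y : {set pairT n}) : c = 1 /\ X \subset Y \/ c = -1 /\ Y \subset X -> B X <= B Y.
  move=> cXY; rewrite /B; have [badX|_] /= := boolP (bad m d0 c q eps X).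
    by rewrite (bad_mono cXY badX); apply: Rle_refl.
  by have := ind_bound (bad m d0 c q eps Y); lra.
have le_B : evolve (@rate n) t B (start (pairT n) c) <= bern q B + / INR n ^ K.+1.
  case: c1 => c1.
    have B_inc : inc B by move=> X Y sXY; apply: B_mono; left.
    by have := dom n t B hn1 t_large B_inc B01; rewrite c1; lra.
  pose f X := 1 * (fun=> 1) X + -1 * B X.
  have f_inc : inc f.
    by move=> X Y sXY; rewrite /f; have := B_mono Y X (or_intror (conj c1 sXY)); lra.
  have f01 : bounded01 f by move=> X; rewrite /f; have := B01 X; lra.
  have := dom n t f hn1 t_large f_inc f01.
  rewrite /f bern_lin bern_const evolve_lin evolve_const // c1; lra.
have le_bern := Rle_trans _ _ _ (hbern n d0 c hn2 c1) (hsmall n hn3).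
apply: Rle_trans le_B _; rewrite -/B in le_bern.
apply: Rle_trans (_ : 2 * / INR n ^ K.+1 <= _); first by lra.
rewrite -(tech_pow_Rmult _ K) Rinv_mult.
have p0 : 0 < / INR n ^ K by apply/Rinv_0_lt_compat/pow_lt; lra.
have : 2 * / INR n <= 1.
  by apply: (Rmult_le_reg_r (INR n)); [lra | rewrite Rmult_assoc Rinv_l; lra].
by nra.
Qed.

(** Outside the bad event [dH] passes [Psi q] by at most [weight1 * eps] in direction [c], and
    [expit] is 1-Lipschitz; [eps] is chosen so that all rates stay on the right side of [q']. *)
Lemma dominated_step c q q' : c = 1 \/ c = -1 -> 0 <= q <= 1 -> 0 <= q' <= 1 ->
  0 < c * (q' - phi q) -> dominated c q -> dominated c q'.
Proof.
move=> c1 q01 q'01 gap dom K.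
pose eps := c * (q' - phi q) / (1 + weight1 E beta).
have w0 := weight1_ge0 E beta.
have eps0 : 0 < eps by apply: Rdiv_lt_0_compat; lra.
have w_eps : weight1 E beta * eps <= c * (q' - phi q).
  have -> : c * (q' - phi q) = (1 + weight1 E beta) * eps by rewrite /eps; field; lra.
  by nra.
have [A [n0 hA]] := bad_unlikely_dominated (K + 4) c1 q01 eps0 dom.
have [n1 hn1] := eventually_ge (2 * INR (K + 3)).
exists (A + (K + 3))%N, (n0 + n1 + 2)%N => n t f n_large t_large f_inc f01.
have hn0 : (n0 <= n)%N by apply: leq_trans n_large; rewrite -addnA leq_addr.
have {}hn1 : 2 * INR (K + 3) <= INR n.
  by apply: hn1; apply: leq_trans n_large; rewrite addnAC leq_addl.
have hn2 : (2 <= n)%N by apply: leq_trans n_large; rewrite leq_addl.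
have [d0 T0] := pairT_exists hn2; have nR := size_gt1 d0.
(* In a window of K + 3 units the bad events add up to at most (K + 3) n^3 n^-(K + 4), and the
   constant-rate chain mixes up to n^2 n^-(2 K + 6); each is at most half of n^-K. *)
pose u := ((K + 3) * tau n)%N.
have le_u : (u <= t)%N by apply: leq_trans t_large; rewrite leq_mul2r leq_addl orbT.
rewrite -(subnK le_u).
have likely v : (t - u <= v)%N ->
    evolve (@rate n) v (fun X => ind (bad m d0 c q eps X)) (start (pairT n) c) <= / INR n ^ (K + 4).
  move=> le_v; apply: hA => //; apply: leq_trans le_v.
  by rewrite leq_subRL // -mulnDl addnC.
have gB X : ~~ bad m d0 c q eps X -> forall e, c * (rate e X - q') <= 0.
  move=> ok e; have := good_dH E first_edge beta_pos e c1 (Rlt_le _ _ eps0) ok.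
  have we0 : 0 <= weight1 E beta * eps by apply: Rmult_le_pos; lra.
  move: w_eps we0; rewrite /edge_rate /phi -/(expit (Psi q)).
  move: (weight1 _ _ * eps) (dH _ _ _ _) (Psi q) => w y z w_eps we0 le_yz.
  have [le|/Rlt_le le] := Rle_lt_dec y z; have := expit_lip le;
    by case: c1 w_eps le_yz => -> w_eps le_yz; lra.
have rr := rate_rates E beta (n := n).
have := domination_transfer T0 q'01 rr c1 gB u f_inc f01 likely.
move/Rle_trans; apply.
have pK : 0 < INR n ^ K by apply: pow_lt; lra.
have iK : 0 < / INR n ^ K by apply: Rinv_0_lt_compat.
have half : / INR n ^ K = / INR n ^ K * / 2 + / INR n ^ K * / 2 by lra.
rewrite half; apply: Rplus_le_compat.
  have -> : / INR n ^ (K + 4) = / INR n ^ K * (/ INR n ^ 3 * / INR n).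
    by rewrite pow_add -!Rinv_mult; congr (/ _); rewrite /=; ring.
  rewrite /u mult_INR; have tc := tau_le_cube (ltnW hn2).
  have -> : INR (K + 3) * INR (tau n) * (/ INR n ^ K * (/ INR n ^ 3 * / INR n)) =
    / INR n ^ K * ((INR (K + 3) * / INR n) * (INR (tau n) * / INR n ^ 3)) by ring.
  apply: Rmult_le_compat_l; first lra.
  have p3 : 0 < INR n ^ 3 by apply: pow_lt; lra.
  have a1 : 0 <= INR (K + 3) * / INR n <= / 2.
    split; first by apply: Rmult_le_pos; [apply: pos_INR | apply/Rlt_le/Rinv_0_lt_compat; lra].
    by apply: (Rmult_le_reg_r (INR n)); [lra | rewrite Rmult_assoc Rinv_l; lra].
  have a2 : 0 <= INR (tau n) * / INR n ^ 3 <= 1.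
    split; first by apply: Rmult_le_pos; [apply: pos_INR | apply/Rlt_le/Rinv_0_lt_compat; lra].
    by apply: (Rmult_le_reg_r (INR n ^ 3)); [lra | rewrite Rmult_assoc Rinv_l; lra].
  by nra.
have [_ sites_le] := sites_bounds hn2.
have := pow_tau (K + 3) hn2 (conj Rle_0_1 (Rle_refl 1)).
have -> : 1 / INR #|pairT n| = / INR #|pairT n| by rewrite /Rdiv Rmult_1_l.
rewrite -/u => pow_le'.
have e_le : exp (- (2 * INR (K + 3) * 1 * ln (INR n))) = / INR n ^ K * / INR n ^ (K + 4) * / INR n ^ 2.
  rewrite exp_Ropp.
  have -> : 2 * INR (K + 3) * 1 * ln (INR n) = INR (2 * (K + 3)) * ln (INR n) by rewrite mult_INR /=; ring.
  rewrite exp_mul_nat exp_ln; last lra.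
  have -> : (2 * (K + 3) = K + (K + 4) + 2)%N by rewrite mul2n -addnn !(addnS, addSn, addn0).
  by rewrite !pow_add !Rinv_mult.
rewrite e_le in pow_le'.
have p2 : 0 < INR n ^ 2 by apply: pow_lt; lra.
have q4 : / INR n ^ (K + 4) <= / 2.
  apply: Rinv_le_contravar; first lra; rewrite addnS -(tech_pow_Rmult _ (K + 3)).
  have : 1 <= INR n ^ (K + 3) by apply: pow_R1_Rle; lra.
  by nra.
have q4' : 0 < / INR n ^ (K + 4) by apply/Rinv_0_lt_compat/pow_lt; lra.
have s0 := pos_INR #|pairT n|.
apply: Rle_trans (_ : INR n ^ 2 * (/ INR n ^ K * / INR n ^ (K + 4) * / INR n ^ 2) <= _).
  apply: Rmult_le_compat => //; [lra | | lra].
  apply: pow_le; have s1 := sites_ge1 T0.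
  have : / INR #|pairT n| <= / 1 by apply: Rinv_le_contravar; lra.
  by lra.
have -> : INR n ^ 2 * (/ INR n ^ K * / INR n ^ (K + 4) * / INR n ^ 2) =
   / INR n ^ K * / INR n ^ (K + 4) * (INR n ^ 2 * / INR n ^ 2) by ring.
rewrite Rinv_r; last lra.
by rewrite Rmult_1_r; apply: Rmult_le_compat_l; lra.
Qed.

End Domination.

(** The minimum over the interval is positive: otherwise [h] would vanish between the minimiser and
    [w]. *)
Lemma positive_gap (h : R -> R) x y w : continuity h -> x <= w <= y -> 0 < h w ->
  (forall z, x <= z <= y -> h z <> 0) -> exists2 eta, 0 < eta & forall z, x <= z <= y -> eta <= h z.
Proof.
move=> h_cont xwy hw h_neq0; have le_xy : x <= y by lra.
have [z [z_min xzy]] := continuity_ab_min h x y le_xy (fun z _ => h_cont z).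
exists (h z) => //; case: (Rlt_le_dec 0 (h z)) => // hz; exfalso.
have [le_zw|/Rlt_le le_wz] := Rle_lt_dec z w.
  have [v [? hv]] := IVT_cor h z w h_cont le_zw ltac:(nra).
  by apply: (h_neq0 v) => //; lra.
have [v [? hv]] := IVT_cor h w z h_cont le_wz ltac:(nra).
by apply: (h_neq0 v) => //; lra.
Qed.

(** * Driving the density to the fixed point from both sides *)

Section Reach.
Variables (s : nat) (m : 'I_s -> nat) (E : forall i : 'I_s, {set pairT (m i)}) (beta : 'I_s -> R).
Hypothesis first_edge : forall i : 'I_s, nat_of_ord i = 0%N -> m i = 2%N.
Hypothesis beta_pos : forall i : 'I_s, (0 < i)%N -> 0 < beta i.
Notation Psi := (Psi E beta).
Notation rate := (edge_rate E beta).
Notation phi := (phi E beta).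
Notation dominated := (dominated E beta).

Lemma derivable_phi q : derivable_pt_lim phi q (expit (Psi q) * (1 - expit (Psi q)) * Psi' E beta q).
Proof.
by apply: (derivable_pt_lim_comp Psi expit); [apply: derivable_Psi | apply: derivable_expit].
Qed.

Lemma phi_continuity : continuity phi.
Proof. by move=> q; apply: derivable_continuous_pt; eexists; apply: derivable_phi. Qed.

Lemma phi01 q : 0 < phi q < 1.
Proof. exact: expit01. Qed.

(** Bernoulli(1) is the point mass at the complete graph, where an increasing [f] is largest. *)
Lemma dominated1 : dominated 1 1.
Proof.
move=> K; exists 0%N, 2%N => n t f n2 _ f_inc f01; have [d0 T0] := pairT_exists n2.
have nR := size_gt1 d0; rewrite start1.
have : 0 < / INR n ^ K by apply/Rinv_0_lt_compat/pow_lt; lra.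
have fT X : 0 <= f X <= f setT by split; [exact: (f01 X).1 | apply: f_inc; apply: subsetT].
have [_ le_fT] := evolve_bound T0 (rate_rates E beta (n := n)) t fT [set: _].
have : bern 1 (fun X : {set pairT n} => f setT * subind setT X + 0 * 0) <= bern 1 f.
  apply: bern_le; first lra; move=> X; rewrite /subind subTset.
  by have [->|_] /= := eqVneq X setT; have := f01 X; have := f01 setT; lra.
by rewrite (bern_lin _ _ (fun=> 0)) bern_const bern_subind pow1; lra.
Qed.

Lemma dominated0 : dominated (-1) 0.
Proof.
move=> K; exists 0%N, 2%N => n t f n2 _ f_inc f01; have [d0 T0] := pairT_exists n2.
have nR := size_gt1 d0; rewrite startN1.
have : 0 < / INR n ^ K by apply/Rinv_0_lt_compat/pow_lt; lra.
have f0 X : f set0 <= f X <= 1 by split; [apply: f_inc; apply: sub0set | exact: (f01 X).2].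
have [le_f0 _] := evolve_bound T0 (rate_rates E beta (n := n)) t f0 set0.
(* [f] exceeds its value at the empty graph by at most the number of edges, which has mean 0 under
   Bernoulli(0). *)
have : bern 0 f <= bern 0 (fun X : {set pairT n} => f set0 * (fun=> 1) X
                           + 1 * (fun Y : {set pairT n} => \rsum_(e : pairT n) subind [set e] Y) X).
  apply: bern_le; first lra; move=> X.
  have ge0 e : true -> 0 <= subind [set e] X.
    by move=> _; rewrite /subind; have := ind_bound ([set e] \subset X); lra.
  have sum0 : 0 <= \rsum_(e : pairT n) subind [set e] X by apply: rsum_ge0.
  have [X0|[e eX]] := set_0Vmem X; first by have fX : f X = f set0; [rewrite X0 | lra].
  have le_sum : 1 <= \rsum_(e : pairT n) subind [set e] X.
    by have := rsum_term_le (j := e) isT ge0; rewrite {1}/subind sub1set eX.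
  by have := f01 X; have := f01 set0; lra.
have bern0 : bern 0 (fun Y : {set pairT n} => \rsum_(e : pairT n) subind [set e] Y) = 0.
  rewrite /bern prodE_sum big1 // => e _.
  by rewrite -/(bern 0 _) bern_subind cards1 pow_1.
by rewrite bern_lin bern_const bern0; lra.
Qed.

(** The density moves from [a] to [p] in steps of at most eta / 2, which leaves the strict gap that
    [dominated_step] asks for; [Rmin] makes the walk stop exactly at [p]. *)
Lemma dominated_reach c a p eta : c = 1 \/ c = -1 -> 0 <= p <= 1 -> 0 <= a <= 1 ->
  0 <= c * (a - p) -> 0 < eta ->
  (forall q, 0 <= c * (q - p) -> 0 <= c * (a - q) -> eta <= c * (q - phi q)) ->
  dominated c a -> dominated c p.
Proof.
move=> c1 p01 a01 D0 eta0 gap dom_a; pose D := c * (a - p).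
pose q k := a - c * Rmin (INR k * (eta / 2)) D.
have cc x : c * (c * x) = x by case: c1 => ->; ring.
have q_range k : 0 <= c * (q k - p) /\ 0 <= c * (a - q k).
  have k0 : 0 <= INR k * (eta / 2) by apply: Rmult_le_pos; [apply: pos_INR | lra].
  have := Rmin_r (INR k * (eta / 2)) D; have : 0 <= Rmin (INR k * (eta / 2)) D by apply: Rmin_glb.
  rewrite /q; move: (Rmin _ _) => r r0 rD.
  have -> : c * (a - c * r - p) = D - c * (c * r) by rewrite /D; ring.
  have -> : c * (a - (a - c * r)) = c * (c * r) by ring.
  by rewrite cc; lra.
have q01 k : 0 <= q k <= 1.
  by have [] := q_range k; case: c1 => ->; lra.
have dom_q k : dominated c (q k).
  elim: k => [|k IHk].
    have -> // : q 0%N = a.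
    by rewrite /q Rmult_0_l Rmin_left ?Rmult_0_r ?Rminus_0_r.
  apply: (dominated_step first_edge beta_pos c1 (q01 k)) IHk => //.
  have [r1 r2] := q_range k; have := gap _ r1 r2.
  have -> : c * (q k.+1 - phi (q k)) = c * (q k - phi (q k)) - (c * (q k - q k.+1)) by ring.
  suff : c * (q k - q k.+1) <= eta / 2 by lra.
  rewrite /q; have -> : forall x y, c * (a - c * x - (a - c * y)) = c * (c * (y - x)) by move=> *; ring.
  rewrite cc S_INR; have := Rmin_l ((INR k + 1) * (eta / 2)) D.
  by rewrite /Rmin; do 2!case: Rle_dec; lra.
have [k hk] := eventually_ge (D / (eta / 2)).
suff -> : p = q k by apply: dom_q.
rewrite /q Rmin_right; first by rewrite /D; case: c1 => ->; ring.
have := hk _ (leqnn k) => hk'; have := Rmult_le_compat_r (eta / 2) _ _ _ hk'.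
by rewrite /Rdiv Rmult_assoc Rinv_l; lra.
Qed.

Variable pstar : R.
Hypothesis pstar01 : 0 <= pstar <= 1.
Hypothesis pstar_unique : forall q, 0 <= q <= 1 -> phi q = q -> q = pstar.

Lemma dominated_above p : pstar < p <= 1 -> dominated 1 p.
Proof.
move=> hp.
have h_cont : continuity (fun q => q - phi q).
  apply: continuity_minus; last exact: phi_continuity.
  by apply: derivable_continuous; apply: derivable_id.
have [|||eta eta0 gap] := positive_gap (w := 1) (x := p) (y := 1) h_cont; first by lra.
- by have := phi01 1; lra.
- move=> z pz h0; have zp : z = pstar by apply: pstar_unique; lra.
  by lra.
apply: (@dominated_reach 1 1 p eta) => //; try lra; try by left.
- by move=> q q1 q2; have := gap q; lra.
- exact: dominated1.
Qed.

Lemma dominated_below p : 0 <= p < pstar -> dominated (-1) p.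
Proof.
move=> hp.
have h_cont : continuity (fun q => phi q - q).
  apply: continuity_minus; first exact: phi_continuity.
  by apply: derivable_continuous; apply: derivable_id.
have [|||eta eta0 gap] := positive_gap (w := 0) (x := 0) (y := p) h_cont; first by lra.
- by have := phi01 0; lra.
- move=> z pz h0; have zp : z = pstar by apply: pstar_unique; lra.
  by lra.
apply: (@dominated_reach (-1) 0 p eta) => //; try lra; try by right.
- by move=> q q1 q2; have := gap q; lra.
- exact: dominated0.
Qed.

Lemma bad_shift n (d0 : pairT n) c p q eps M X : c = 1 \/ c = -1 -> 0 <= p <= 1 -> 0 <= q <= 1 ->
  (forall i (S : {set pairT (m i)}), INR #|S| <= M) -> 2 * (M * Rabs (p - q)) <= eps / 2 ->
  bad m d0 c p eps X -> bad m d0 c q (eps / 2) X.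
Proof.
move=> c1 p01 q01 M_ge le_eps /existsP[jf /andP[ok /leRP le_stat]].
apply/existsP; exists jf; rewrite ok; apply/leRP.
have := pow_close #|(tagged jf.1).2| p01 q01.
have := Rmult_le_compat_r _ _ _ (Rabs_pos (p - q)) (M_ge _ (tagged jf.1).2).
move: le_stat le_eps; move: (stat _ _ _ _ _) (p ^ _) (q ^ _) (M * _) (INR _ * _) => a y z v w.
by rewrite /Rabs; case: Rcase_abs; case: c1 => ->; lra.
Qed.

(** Domination is available at densities strictly beyond pstar; the shift by [r] towards the
    starting state is paid for with half of [eps]. *)
Lemma bad_unlikely_star c eps K : c = 1 \/ c = -1 -> 0 < pstar < 1 -> 0 < eps ->
  exists A n0 : nat, forall n t (d0 : pairT n), (n0 <= n)%N -> (A * tau n <= t)%N ->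
  evolve (@rate n) t (fun X => ind (bad m d0 c pstar eps X)) (start (pairT n) c)
    <= / INR n ^ K.
Proof.
move=> c1 ps01 eps0; have [M [M1 M_ge]] := edge_bound m.
pose r := Rmin (eps / (4 * M)) (Rmin (pstar / 2) ((1 - pstar) / 2)).
have r0 : 0 < r.
  by rewrite /r; do ?apply: Rmin_glb_lt; try lra; apply: Rdiv_lt_0_compat; lra.
have r1 : r <= eps / (4 * M) by apply: Rmin_l.
have r2 : r <= pstar / 2 by apply: Rle_trans (Rmin_r _ _) _; apply: Rmin_l.
have r3 : r <= (1 - pstar) / 2 by apply: Rle_trans (Rmin_r _ _) _; apply: Rmin_r.
pose q := pstar + c * r.
have q01 : 0 <= q <= 1 by rewrite /q; case: c1 => ->; lra.
have dom_q : dominated c q.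
  rewrite /q; case: c1 => ->; [apply: dominated_above | apply: dominated_below]; lra.
have eps2 : 0 < eps / 2 by lra.
have [A [n0 hA]] := bad_unlikely_dominated K c1 q01 eps2 dom_q.
exists A, n0 => n t d0 n_large t_large.
apply: Rle_trans (hA n t d0 n_large t_large).
have T0 : (0 < #|pairT n|)%N by apply/card_gt0P; exists d0.
apply: (evolve_le T0) => [|X]; first exact: rate_rates.
have [badX|_] /= := boolP (bad m d0 c pstar eps X).
  rewrite (bad_shift c1 _ q01 M_ge _ badX) //; first exact: Rle_refl.
  have -> : Rabs (pstar - q) = r by rewrite /q /Rabs; case: Rcase_abs; case: c1 => ->; lra.
  have := Rmult_le_compat_l M _ _ ltac:(lra) r1.
  have -> : M * (eps / (4 * M)) = eps / 4 by field; lra.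
  by lra.
by have := ind_bound (bad m d0 c q (eps / 2) X); lra.
Qed.

Variable d : R.
Hypotheses (d_deriv : derivable_pt_lim phi pstar d) (d_lt1 : d < 1).

Lemma contraction_constants : exists eps delta, 0 < eps /\ 0 < delta <= 1 /\
  (expit (Psi pstar) * (1 - expit (Psi pstar)) + weight1 E beta * eps)
     * (Psi' E beta pstar + weight2 E beta * eps) <= 1 - delta.
Proof.
have dE := uniqueness_limite _ _ _ _ d_deriv (derivable_phi pstar).
have := expit01 (Psi pstar); have w1 := weight1_ge0 E beta; have w2 := weight2_ge0 E beta.
move: dE; move: (weight1 _ _) (weight2 _ _) w1 w2 (Psi' _ _ _) (expit _) => a b a0 b0 y x dE x01.
have l0 : 0 < x * (1 - x) by nra.
move: (x * (1 - x)) dE l0 => l dE l0.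
(* For [eps] <= 1 the product exceeds its value d at [eps] = 0 by at most [K * eps]; half of the gap
   1 - d then remains for [delta]. *)
pose K := l * b + a * Rabs y + a * b.
have K0 : 0 <= K by have := Rabs_pos y; rewrite /K; nra.
pose eps := Rmin 1 ((1 - d) / (2 * (1 + K))).
have eps0 : 0 < eps by apply: Rmin_glb_lt; [lra | apply: Rdiv_lt_0_compat; lra].
have eps1 : eps <= 1 by apply: Rmin_l.
have epsK : K * eps <= (1 - d) / 2.
  have : eps <= (1 - d) / (2 * (1 + K)) by apply: Rmin_r.
  move/(Rmult_le_compat_l (1 + K) _ _ ltac:(lra)).
  have -> : (1 + K) * ((1 - d) / (2 * (1 + K))) = (1 - d) / 2 by field; lra.
  by lra.
exists eps, (Rmin 1 ((1 - d) / 2)); split => //; split.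
  by split; [apply: Rmin_glb_lt; lra | apply: Rmin_l].
have : (l + a * eps) * (y + b * eps) <= d + K * eps.
  rewrite dE /K; have := Rle_abs y => yy.
  have : a * y * eps <= a * Rabs y * eps by apply: Rmult_le_compat_r; [lra | apply: Rmult_le_compat_l].
  have : a * b * (eps * eps) <= a * b * eps by apply: Rmult_le_compat_l; nra.
  by lra.
by have := Rmin_r 1 ((1 - d) / 2); lra.
Qed.

End Reach.

(** * Mixing time *)

Section Mixing.
Variables (s : nat) (m : 'I_s -> nat) (E : forall i : 'I_s, {set pairT (m i)}) (beta : 'I_s -> R).
Hypothesis first_edge : forall i : 'I_s, nat_of_ord i = 0%N -> m i = 2%N.
Hypothesis beta_pos : forall i : 'I_s, (0 < i)%N -> 0 < beta i.
Notation rate := (edge_rate E beta).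

Section Size.
Variables (n : nat) (d0 : pairT n).
Implicit Types (X Y x : graph n) (f : graph n -> R) (e : pairT n).
Notation sites := (INR #|pairT n|).

Lemma sites_gt0 : (0 < #|pairT n|)%N. Proof. by apply/card_gt0P; exists d0. Qed.

Lemma glauber_step f X : \rsum_(Y : graph n) (glauber E beta X Y * f Y) = step (@rate n) f X.
Proof.
rewrite /step card_pairT rsum_distrr.
rewrite (eq_bigr (fun Y => \rsum_(e : pairT n) (/ INR 'C(n, 2) *
  (ind (Y == e |: X) * (rate e X * f Y) + ind (Y == X :\ e) * ((1 - rate e X) * f Y))))) => [|Y _].
  rewrite exchange_big; apply: eq_bigr => e _; rewrite -rsum_distrr big_split /=.
  by rewrite (rsum_eqop (e |: X) (fun Y => rate e X * f Y)) (rsum_eqop (X :\ e) (fun Y => (1 - rate e X) * f Y)).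
rewrite /glauber sumRE Rmult_comm rsum_distrr; apply: eq_bigr => e _.
by rewrite /rate /expit; case: (Y == e |: X); case: (Y == X :\ e) => /=; ring.
Qed.

(** Duality between laws, pushed forward by the kernel, and functions, pulled back by [step]. *)
Lemma law_evolve t f x : \rsum_(Y : graph n) (law E beta t x Y * f Y) = evolve (@rate n) t f x.
Proof.
elim: t f => [|t IHt] f.
  rewrite (eq_bigr (fun Y => ind (Y == x) * f Y)) => [|Y _]; last by rewrite /= /ind; case: eqP.
  exact: rsum_eqop.
rewrite evolveSr -IHt.
rewrite (eq_bigr (fun Y => \rsum_(X : graph n) (law E beta t x X * glauber E beta X Y * f Y))) => [|Y _].
  rewrite exchange_big; apply: eq_bigr => X _ /=; rewrite -glauber_step rsum_distrr.
  by apply: eq_bigr => Y _; ring.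
by rewrite /= sumRE Rmult_comm rsum_distrr; apply: eq_bigr => X _; ring.
Qed.

Lemma gibbs_norm_gt0 : 0 < \rsum_(Y : graph n) exp (Ham E beta Y).
Proof.
apply: Rlt_le_trans (exp_pos (Ham E beta (set0 : graph n))) _.
by apply: (rsum_term_le (F := fun Y : graph n => exp (Ham E beta Y))) => // Y _; apply/Rlt_le/exp_pos.
Qed.

Lemma gibbs_ge0 X : 0 <= gibbs E beta X.
Proof.
rewrite /gibbs sumRE; apply: Rmult_le_pos; first exact/Rlt_le/exp_pos.
by apply/Rlt_le/Rinv_0_lt_compat; apply: gibbs_norm_gt0.
Qed.

Lemma gibbs_sum : \rsum_(X : graph n) gibbs E beta X = 1.
Proof.
have Z0 := gibbs_norm_gt0; rewrite /gibbs sumRE.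
rewrite (eq_bigr (fun X => / (\rsum_(Y : graph n) exp (Ham E beta Y)) * exp (Ham E beta X))) => [|X _].
  by rewrite -rsum_distrr Rinv_l //; lra.
by rewrite /Rdiv Rmult_comm.
Qed.

Lemma gibbs_balance e X :
  gibbs E beta (e |: X) * (1 - rate e X) = gibbs E beta (X :\ e) * rate e X.
Proof.
have Z0 := gibbs_norm_gt0; rewrite /gibbs sumRE /rate /expit /dH.
rewrite /Rminus exp_plus exp_Ropp.
have := exp_pos (Ham E beta (e |: X)); have := exp_pos (Ham E beta (X :\ e)).
move: (exp _) (exp _) (bigop _ _ _) Z0 => a b Z Z0 a0 b0.
by field; repeat split; nra.
Qed.

Lemma tv_spread t x : tv_dist E beta t x <= 2 * spread (@rate n) t.
Proof.
rewrite /tv_dist sumRE.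
(* The sign of the signed measure attains the sum of absolute values, and it has modulus 1 as
   [distance_to_stationary] requires. *)
pose f Y := if Rle_dec 0 (law E beta t x Y - gibbs E beta Y) then 1 else -1.
have -> : \rsum_(Y : graph n) Rabs (law E beta t x Y - gibbs E beta Y) =
    evolve (@rate n) t f x - \rsum_(Y : graph n) (gibbs E beta Y * f Y).
  rewrite -law_evolve -rsum_sub; apply: eq_bigr => Y _.
  rewrite -Rmult_minus_distr_r /f; move: (law _ _ _ _ _ - _) => z.
  case: Rle_dec => z0 /=; first by rewrite Rabs_pos_eq ?Rmult_1_r.
  by rewrite (Rabs_left _ (Rnot_le_lt _ _ z0)); lra.
have f1 Z : Rabs (f Z) <= 1.
  by rewrite /f; case: Rle_dec => ? /=; rewrite ?Rabs_Ropp Rabs_R1; lra.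
have le4 : evolve (@rate n) t f x - \rsum_(Y : graph n) (gibbs E beta Y * f Y) <= 4 * spread (@rate n) t.
  apply: (distance_to_stationary sites_gt0 (rate_rates E beta (n := n)) x
    (rate_inc E first_edge beta_pos d0) gibbs_balance gibbs_ge0 gibbs_sum f1).
  exact: Rle_refl.
by lra.
Qed.

Lemma tv_test t x f : (forall Y, 0 <= f Y <= 1) ->
  Rabs (evolve (@rate n) t f x - \rsum_(Y : graph n) (gibbs E beta Y * f Y)) <= tv_dist E beta t x.
Proof.
move=> f01; rewrite /tv_dist sumRE.
have law_sum : \rsum_(Y : graph n) law E beta t x Y = 1.
  rewrite -(evolve_const sites_gt0 (@rate n) t 1 x) -law_evolve.
  by apply: eq_bigr => Y _; rewrite Rmult_1_r.
(* Both laws have mass 1, so [f] may be centred at 1/2; this yields the factor 1/2. *)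
have -> : evolve (@rate n) t f x - \rsum_(Y : graph n) (gibbs E beta Y * f Y) =
    \rsum_(Y : graph n) ((law E beta t x Y - gibbs E beta Y) * (f Y - / 2)).
  rewrite -law_evolve.
  rewrite [RHS](eq_bigr (fun Y => (law E beta t x Y * f Y - gibbs E beta Y * f Y)
     - (/ 2 * law E beta t x Y - / 2 * gibbs E beta Y))) => [|Y _]; last by ring.
  by rewrite !rsum_sub -!rsum_distrr law_sum gibbs_sum; ring.
apply: Rle_trans (rsum_abs _ _) _; rewrite rsum_distrr; apply: rsum_le => Y _.
rewrite Rabs_mult Rmult_comm; apply: Rmult_le_compat_r; first exact: Rabs_pos.
by have := f01 Y; rewrite /Rabs; case: Rcase_abs; lra.
Qed.

Lemma sizeR_lip : lip (@sizeR (pairT n)) 1.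
Proof.
move=> e X; rewrite /dif sizeR_U1.
have -> : sizeR (X :\ e) + 1 - sizeR (X :\ e) = 1 by ring.
by rewrite Rabs_R1; apply: Rle_refl.
Qed.

(* Chebyshev for the number of edges: the chains started from the complete and
   the empty graph are told apart as long as their standard deviations are
   small compared with the difference of their means. *)
Lemma tv_lower t V : 0 < spread (@rate n) t ->
  (forall x : {set pairT n}, evolve (@rate n) t (fun Y : {set pairT n} => sizeR Y ^ 2) x <= evolve (@rate n) t (@sizeR _) x ^ 2 + V) ->
  (forall x, tv_dist E beta t x <= exp (-1)) ->
  1 - 8 * V / spread (@rate n) t ^ 2 <= 2 * exp (-1).
Proof.
move=> S0 var mixed; set S := spread _ _ in S0 *.
pose a := evolve (@rate n) t (@sizeR _) [set: pairT n].
pose b := evolve (@rate n) t (@sizeR _) set0.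
have SE : S = a - b by [].
(* Threshold halfway between the means: each error is at most V / (S / 2)^2, and two of them give 8
   V / S^2. *)
pose h (Y : {set pairT n}) := ind (leR (b + S / 2) (sizeR Y)).
have h01 Y : 0 <= h Y <= 1 by apply: ind_bound.
have S2 : 0 < / (S / 2) ^ 2 by apply/Rinv_0_lt_compat/pow_lt; lra.
have sq c (x : {set pairT n}) : evolve (@rate n) t (fun Y : {set pairT n} => (sizeR Y - c) ^ 2) x =
   evolve (@rate n) t (fun Y : {set pairT n} => sizeR Y ^ 2) x - 2 * c * evolve (@rate n) t (@sizeR _) x + c ^ 2.
  have -> : (fun Y : {set pairT n} => (sizeR Y - c) ^ 2) =
      fun Y : {set pairT n} => 1 * sizeR Y ^ 2 + 1 * (- (2 * c) * sizeR Y + c ^ 2 * 1).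
    by apply: functional_extensionality => Y; ring.
  rewrite evolve_lin (evolve_lin _ _ (@sizeR _) (fun=> 1)) evolve_const; [ring | exact: sites_gt0].
have lo : evolve (@rate n) t h set0 <= / (S / 2) ^ 2 * V.
  apply: Rle_trans (_ : evolve (@rate n) t (fun Y : {set pairT n} => / (S / 2) ^ 2 * (sizeR Y - b) ^ 2 + 0 * 0) set0 <= _).
    apply: (evolve_le sites_gt0); first exact: rate_rates.
    move=> Y; rewrite /h; case: leRP => hY; rewrite /ind.
      have : (S / 2) ^ 2 <= (sizeR Y - b) ^ 2 by apply: pow_incr; lra.
      move/(Rmult_le_compat_l _ _ _ (Rlt_le _ _ S2)); rewrite Rinv_l; first lra.
      by apply: pow_nonzero; lra.
    by have := Rmult_le_pos _ _ (Rlt_le _ _ S2) (pow2_ge_0 (sizeR Y - b)); lra.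
  rewrite (evolve_lin _ _ (fun Y : {set pairT n} => (sizeR Y - b) ^ 2) (fun=> 0)) sq Rmult_0_l Rplus_0_r.
  apply: Rmult_le_compat_l; first lra.
  by have := var set0; rewrite -/b; lra.
have hi : 1 - evolve (@rate n) t h [set: pairT n] <= / (S / 2) ^ 2 * V.
  have -> : 1 - evolve (@rate n) t h [set: pairT n] =
      evolve (@rate n) t (fun Y : {set pairT n} => 1 * (fun=> 1) Y + -1 * h Y) [set: pairT n].
    by rewrite evolve_lin evolve_const; [ring | exact: sites_gt0].
  apply: Rle_trans (_ : evolve (@rate n) t (fun Y : {set pairT n} => / (S / 2) ^ 2 * (sizeR Y - a) ^ 2 + 0 * 0) [set: pairT n] <= _).
    apply: (evolve_le sites_gt0); first exact: rate_rates.
    move=> Y; rewrite /h; case: leRP => hY; rewrite /ind.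
      by have := Rmult_le_pos _ _ (Rlt_le _ _ S2) (pow2_ge_0 (sizeR Y - a)); lra.
    have : (S / 2) ^ 2 <= (a - sizeR Y) ^ 2 by apply: pow_incr; lra.
    have -> : (a - sizeR Y) ^ 2 = (sizeR Y - a) ^ 2 by ring.
    move/(Rmult_le_compat_l _ _ _ (Rlt_le _ _ S2)); rewrite Rinv_l; first lra.
    by apply: pow_nonzero; lra.
  rewrite (evolve_lin _ _ (fun Y : {set pairT n} => (sizeR Y - a) ^ 2) (fun=> 0)) sq Rmult_0_l Rplus_0_r.
  apply: Rmult_le_compat_l; first lra.
  by have := var [set: pairT n]; rewrite -/a; lra.
have := Rle_trans _ _ _ (tv_test t [set: pairT n] h01) (mixed [set: pairT n]).
have := Rle_trans _ _ _ (tv_test t set0 h01) (mixed set0).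
have -> : 8 * V / S ^ 2 = 2 * (/ (S / 2) ^ 2 * V) by field; lra.
by rewrite /Rabs; do 2!case: Rcase_abs; lra.
Qed.

End Size.

(** The lower bound follows from exp 1 <= 3, the upper one from exp (1/2) >= 3/2, squared. *)
Lemma exp_m1_bounds : / 4 <= exp (-1) < 9 / 20.
Proof.
have e1 : 9 / 4 <= exp 1.
  have -> : exp 1 = exp (/ 2) * exp (/ 2) by rewrite -exp_plus; congr exp; lra.
  by have := exp_ineq1_le (/ 2); nra.
have e3 := exp_le_3; have -> : exp (-1) = / exp 1 by rewrite -exp_Ropp.
split; first by apply: Rinv_le_contravar; lra.
apply: Rle_lt_trans (_ : / (9 / 4) < _); last lra.
by apply: Rinv_le_contravar; lra.
Qed.

Lemma mixing_lower : exists2 c, 0 < c & exists n0 : nat, forall n t, (n0 <= n)%N ->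
  INR t <= c * INR n ^ 2 * ln (INR n) -> exists x : graph n, exp (-1) < tv_dist E beta t x.
Proof.
pose C := weight2 E beta * 2.
have C0 : 0 <= C by rewrite /C; have := weight2_ge0 E beta; lra.
(* With l = ln n, the variance bound grows like exp (8 C c l) and the squared spread decays at most
   like exp (- 16 c l); this [c] makes their combined exponential factor exp (l / 2), the square
   root of n. *)
pose c := / (2 * (8 * C + 16)).
have c0 : 0 < c by apply: Rinv_0_lt_compat; lra.
have cE : c * (8 * C + 16) = / 2 by rewrite /c; field; lra.
have c32 : 16 * c <= / 2 by nra.
(* From 10000 on the square root of n is at least 100, which brings the variance over the squared
   spread below 1/100. *)
exists c => //; have [n1 hn1] := eventually_ge 10000; exists (n1 + 2)%N => n t n_large t_le.
have hn2 : (2 <= n)%N by apply: leq_trans n_large; rewrite leq_addl.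
have {}hn1 : 10000 <= INR n by apply: hn1; apply: leq_trans n_large; rewrite leq_addr.
have [d0 _] := pairT_exists hn2; have T0 := sites_gt0 d0.
apply: NNPP => no_x.
have mixed (x : graph n) : tv_dist E beta t x <= exp (-1).
  by apply: Rnot_lt_le => lt_x; apply: no_x; exists x.
have [slo shi] := sites_bounds hn2.
set N := INR #|pairT n| in slo shi.
have N1 : 2 <= N by nra.
have iN : 0 < / N <= / 2 by split; [apply: Rinv_0_lt_compat | apply: Rinv_le_contravar]; lra.
set l := ln (INR n) in t_le.
have l0 : 0 <= l by apply: ln_ge0; apply: ltnW.
have ln_le : l <= INR n.
  by have := exp_ineq1_le l; rewrite /l exp_ln; lra.
have t0 := pos_INR t.
have tN : INR t * / N <= 4 * c * l.
  apply: (Rmult_le_reg_r N); first lra; rewrite Rmult_assoc Rinv_l; last lra.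
  rewrite Rmult_1_r; apply: Rle_trans t_le _.
  have : 0 <= c * l by apply: Rmult_le_pos; lra.
  by nra.
pose y := exp (l / 2).
have yy : y * y = INR n.
  rewrite /y -exp_plus; have -> : l / 2 + l / 2 = l by lra.
  by rewrite /l exp_ln; lra.
have y0 : 0 < y by apply: exp_pos.
have y100 : 100 <= y by nra.
have exp_le u v : u <= v -> exp u <= exp v.
  by case=> [/exp_increasing/Rlt_le|->]; [|apply: Rle_refl].
have S_lo : N * exp (- (8 * c * l)) <= spread (@rate n) t.
  apply: Rle_trans (spread_lower T0 (rate_rates E beta (n := n)) (rate_inc E first_edge beta_pos d0) t).
  rewrite -/N; apply: Rmult_le_compat_l; first lra.
  (* Uses 1 - 1 / N >= exp (- 2 / N), valid for N >= 2. *)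
  apply: Rle_trans (_ : exp (- (2 * / N)) ^ t <= _); last first.
    apply: pow_incr; split; first exact/Rlt_le/exp_pos.
    rewrite exp_Ropp; apply: (Rmult_le_reg_l (exp (2 * / N))); first exact: exp_pos.
    rewrite Rinv_r; last by have := exp_pos (2 * / N); lra.
    by have := exp_ineq1_le (2 * / N); nra.
  by rewrite -exp_mul_nat; apply: exp_le; lra.
have S0 : 0 < N * exp (- (8 * c * l)) by apply: Rmult_lt_0_compat; [lra | apply: exp_pos].
pose V := INR t * ((1 + C / N) ^ t) ^ 2.
have var (x : graph n) := evolve_variance T0 (rate_rates E beta (n := n)) t C0 (sizeR_lip (n := n))
  (sum_dif_rate_bound E first_edge beta_pos d0) x.
have := tv_lower d0 (Rlt_le_trans _ _ _ S0 S_lo) var mixed.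
rewrite -/N -/V.
have V_le : V <= c * INR n ^ 2 * l * exp (8 * C * c * l).
  apply: Rmult_le_compat => //; first by apply: pow2_ge_0.
  apply: Rle_trans (_ : (exp (C / N) ^ t) ^ 2 <= _).
    have CN : 0 <= C / N by apply: Rmult_le_pos; lra.
    apply: pow_incr; split; first by apply: pow_le; lra.
    by apply: pow_incr; have := exp_ineq1_le (C / N); lra.
  rewrite -!exp_mul_nat; apply: exp_le.
  have : C * (INR t * / N) <= C * (4 * c * l) by apply: Rmult_le_compat_l.
  by rewrite /Rdiv /=; lra.
have S2 : N ^ 2 * exp (- (16 * c * l)) <= spread (@rate n) t ^ 2.
  have -> : N ^ 2 * exp (- (16 * c * l)) = (N * exp (- (8 * c * l))) ^ 2.
    rewrite Rpow_mult_distr; congr (_ * _); rewrite /= Rmult_1_r -exp_plus; congr exp; ring.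
  by apply: pow_incr; lra.
have S2' : 0 < N ^ 2 * exp (- (16 * c * l)).
  by apply: Rmult_lt_0_compat; [apply: pow_lt; lra | apply: exp_pos].
have V0 : 0 <= V by apply: Rmult_le_pos => //; apply: pow2_ge_0.
have ratio : V / spread (@rate n) t ^ 2 <= / 100.
  apply: (Rmult_le_reg_r (spread (@rate n) t ^ 2)); first lra.
  rewrite /Rdiv Rmult_assoc Rinv_l; last lra.
  rewrite Rmult_1_r; apply: Rle_trans V_le _.
  apply: Rle_trans (_ : / 100 * (N ^ 2 * exp (- (16 * c * l))) <= _); last lra.
  apply: (Rmult_le_reg_r (exp (16 * c * l))); first exact: exp_pos.
  have e1 : exp (8 * C * c * l) * exp (16 * c * l) = y.
    rewrite -exp_plus /y; congr exp.
    have -> : 8 * C * c * l + 16 * c * l = (c * (8 * C + 16)) * l by ring.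
    by rewrite cE; lra.
  have e2 : exp (- (16 * c * l)) * exp (16 * c * l) = 1.
    by rewrite -exp_plus Rplus_opp_l exp_0.
  have -> : c * INR n ^ 2 * l * exp (8 * C * c * l) * exp (16 * c * l) =
    c * (INR n ^ 2 * (l * y)) by rewrite -e1; ring.
  have -> : / 100 * (N ^ 2 * exp (- (16 * c * l))) * exp (16 * c * l) = / 100 * (N ^ 2 * 1).
    by rewrite -e2; ring.
  have N2 : (INR n ^ 2 / 4) ^ 2 <= N ^ 2 by apply: pow_incr; split => //; have := pow2_ge_0 (INR n); lra.
  have n2 := pow2_ge_0 (INR n).
  have c32' : c <= / 32 by lra.
  have : c * (INR n ^ 2 * (l * y)) <= / 32 * (INR n ^ 2 * (INR n * y)).
    apply: Rmult_le_compat => //; [lra | | ].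
      by apply: Rmult_le_pos => //; apply: Rmult_le_pos; lra.
    by apply: Rmult_le_compat_l => //; apply: Rmult_le_compat_r; lra.
  have : 100 * (INR n * y) <= INR n ^ 2 by rewrite -yy; nra.
  by nra.
(* The numerical contradiction is 1 - 8/100 > 2 (9/20). *)
have [_ e9] := exp_m1_bounds.
have -> : 8 * V / spread (@rate n) t ^ 2 = 8 * (V / spread (@rate n) t ^ 2) by rewrite /Rdiv; ring.
lra.
Qed.

Lemma mixing_upper : high_temperature E beta -> exists A n0 : nat, forall n (x : graph n),
  (n0 <= n)%N -> tv_dist E beta (A * tau n) x <= exp (-1).
Proof.
case=> p [[p01 p_fix] [p_uniq [d [d_der d1]]]].
have [eps [delta [eps0 [delta01 contr]]]] := contraction_constants d_der d1.
have p01' : 0 < p < 1 by have := phi01 E beta p; lra.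
(* With exponent 3 the additive term 8 eta N / delta of [spread_upper] is of order 1 / n. *)
have [A1 [n1 hA1]] := bad_unlikely_star first_edge beta_pos p01 p_uniq 3 (or_introl erefl) p01' eps0.
have [A2 [n2 hA2]] := bad_unlikely_star first_edge beta_pos p01 p_uniq 3 (or_intror erefl) p01' eps0.
(* Since k delta >= 2, the contraction over k units is at most n^-4, against an initial spread of at
   most n^2 / 2. *)
have [k hk] := eventually_ge (2 / delta); have {}hk := hk _ (leqnn k).
have [n3 hn3] := eventually_ge (64 / delta + 16).
exists (A1 + A2 + k)%N, (n1 + n2 + n3 + 2)%N => n x n_large.
have hn1 : (n1 <= n)%N by apply: leq_trans n_large; rewrite -!addnA leq_addr.
have hn2 : (n2 <= n)%N by apply: leq_trans n_large; rewrite -!addnA addnCA leq_addr.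
have {}hn3 : 64 / delta + 16 <= INR n.
  by apply: hn3; apply: leq_trans n_large; rewrite -addnA addnCA leq_addr.
have n_ge2 : (2 <= n)%N by apply: leq_trans n_large; rewrite leq_addl.
have [d0 T0] := pairT_exists n_ge2.
apply: Rle_trans (tv_spread d0 _ _) _; rewrite mulnDl.
have d_inv : 0 < / delta by apply: Rinv_0_lt_compat; lra.
have nR : 16 <= INR n by rewrite /Rdiv in hn3; lra.
have eta0 : 0 <= / INR n ^ 3 by apply/Rlt_le/Rinv_0_lt_compat/pow_lt; lra.
pose U (X : {set pairT n}) := ~~ bad m d0 (-1) p eps X.
pose W (X : {set pairT n}) := ~~ bad m d0 1 p eps X.
have U_up (X Y : {set pairT n}) : X \subset Y -> U X -> U Y.
  by move=> sXY; apply: contra; apply: bad_mono; right.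
have W_down (X Y : {set pairT n}) : X \subset Y -> W Y -> W X.
  by move=> sXY; apply: contra; apply: bad_mono; left.
have W_likely t : ((A1 + A2) * tau n <= t)%N -> evolve (@rate n) t (fun X => ind (~~ W X)) [set: pairT n] <= / INR n ^ 3.
  move=> le_t; have -> : (fun X => ind (~~ W X)) = fun X => ind (bad m d0 1 p eps X).
    by apply: functional_extensionality => X; rewrite /W negbK.
  rewrite -(start1 (pairT n)); apply: hA1 => //.
  by apply: leq_trans le_t; rewrite leq_mul2r leq_addr orbT.
have U_likely t : ((A1 + A2) * tau n <= t)%N -> evolve (@rate n) t (fun X => ind (~~ U X)) set0 <= / INR n ^ 3.
  move=> le_t; have -> : (fun X => ind (~~ U X)) = fun X => ind (bad m d0 (-1) p eps X).
    by apply: functional_extensionality => X; rewrite /U negbK.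
  rewrite -(startN1 (pairT n)); apply: hA2 => //.
  by apply: leq_trans le_t; rewrite leq_mul2r leq_addl orbT.
have contr' e X : U (X :\ e) -> W (e |: X) -> \rsum_(d : pairT n) dif e (rate d) X <= 1 - delta.
  by apply: (good_contraction first_edge beta_pos); first lra.
have := spread_upper T0 (rate_rates E beta (n := n)) (rate_inc E first_edge beta_pos d0)
  delta01 eta0 U_up W_down contr' W_likely U_likely (k * tau n).
have [_ sites_le] := sites_bounds n_ge2.
have d01 : 0 <= delta <= 1 by lra.
have pt := pow_tau k n_ge2 d01.
have kd : 2 <= INR k * delta.
  have := Rmult_le_compat_r delta _ _ ltac:(lra) hk.
  by rewrite /Rdiv Rmult_assoc Rinv_l; lra.
have l0 : 0 <= ln (INR n) by apply: ln_ge0; apply: ltnW.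
have e4 : exp (- (2 * INR k * delta * ln (INR n))) <= / INR n ^ 4.
  have -> : / INR n ^ 4 = exp (- (INR 4 * ln (INR n))).
    by rewrite exp_Ropp exp_mul_nat exp_ln //; lra.
  have le4 : - (2 * INR k * delta * ln (INR n)) <= - (INR 4 * ln (INR n)).
    have -> : INR 4 = 4 by rewrite /=; ring.
    by nra.
  by case: le4 => [/exp_increasing/Rlt_le|->]; [|apply: Rle_refl].
have n2p : 0 < INR n ^ 2 by apply: pow_lt; lra.
have n1i : / INR n <= / 16 by apply: Rinv_le_contravar; lra.
have main : INR #|pairT n| * (1 - delta / INR #|pairT n|) ^ (k * tau n) <= / 32.
  apply: Rle_trans (_ : INR n ^ 2 / 2 * / INR n ^ 4 <= _).
    apply: Rmult_le_compat => //; [exact: pos_INR | | exact: Rle_trans pt e4].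
    apply: pow_le; have s1 := sites_ge1 T0.
    have : delta / INR #|pairT n| <= 1.
      by apply: (Rmult_le_reg_r (INR #|pairT n|)); [lra | rewrite /Rdiv Rmult_assoc Rinv_l; lra].
    by lra.
  have -> : INR n ^ 2 / 2 * / INR n ^ 4 = / 2 * (/ INR n * / INR n) by field; lra.
  have : 0 < / INR n by apply: Rinv_0_lt_compat; lra.
  by nra.
have err : 8 * / INR n ^ 3 * INR #|pairT n| / delta <= / 16.
  apply: Rle_trans (_ : 8 * / INR n ^ 3 * (INR n ^ 2 / 2) / delta <= _).
    by apply: Rmult_le_compat_r; [lra | apply: Rmult_le_compat_l; lra].
  have -> : 8 * / INR n ^ 3 * (INR n ^ 2 / 2) / delta = (4 / delta) * / INR n by field; lra.
  apply: (Rmult_le_reg_r (INR n)); first lra.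
  by rewrite /Rdiv !Rmult_assoc Rinv_l; rewrite /Rdiv in hn3; lra.
(* 2 (1/32 + 1/16) <= 1/4 <= exp (-1). *)
have [e_lo _] := exp_m1_bounds; lra.
Qed.

End Mixing.

Theorem theorem1 (s : nat) (m : 'I_s -> nat)
  (E : forall i : 'I_s, {set pairT (m i)}) (beta : 'I_s -> R) :
  (0 < s)%N ->
  (* G_1 (index 0) is the single edge on vertex set {1,2} *)
  (forall i : 'I_s, nat_of_ord i = 0%N -> m i = 2%N /\ E i = setT) ->
  (forall i : 'I_s, (0 < i)%N -> (0 < beta i)%R) ->
  high_temperature E beta ->
  exists c C : R, (0 < c)%R /\ (c < C)%R /\
    exists N : nat, forall n : nat, (N <= n)%N ->
      exists t : nat, is_mixing_time E beta n t /\
        (c * INR n ^ 2 * ln (INR n) <= INR t)%R /\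
        (INR t <= C * INR n ^ 2 * ln (INR n))%R.
Proof.
move=> _ edge beta_pos high.
have first_edge i (i0 : nat_of_ord i = 0%N) : m i = 2%N := (edge i i0).1.
have [c c0 [n1 lower]] := mixing_lower E first_edge beta_pos.
have [A [n2 upper]] := mixing_upper first_edge beta_pos high.
(* The term 2 A appears because tau n <= 2 n^2 ln n for n >= 3; adding c + 1 ensures c < C. *)
exists c, (c + 2 * INR A + 1); split => //; split; first by have := pos_INR A; lra.
exists (n1 + n2 + 3)%N => n n_large.
have hn1 : (n1 <= n)%N by apply: leq_trans n_large; rewrite -addnA leq_addr.
have hn2 : (n2 <= n)%N by apply: leq_trans n_large; rewrite addnAC leq_addl.
have n3 : (3 <= n)%N by apply: leq_trans n_large; rewrite leq_addl.
pose mixed t := forall x : graph n, tv_dist E beta t x <= exp (-1).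
(* Least mixed time by descent; excluded middle is needed because [mixed] compares reals. *)
have [t [t_mixed t_min]] : exists t, mixed t /\ forall t', (t' < t)%N -> ~ mixed t'.
  have : exists t, mixed t by exists (A * tau n)%N => x; apply: upper.
  case=> t; elim/ltn_ind: t => t IHt ht.
  have [[t' [lt_t' ht']]|none] := classic (exists t', (t' < t)%N /\ mixed t').
    exact: IHt lt_t' ht'.
  by exists t; split => // t' lt_t' ht'; apply: none; exists t'.
exists t; split; [split => // t' /t_min not_mixed | split].
- apply: NNPP => none; apply: not_mixed => x.
  by apply: Rnot_lt_le => lt_x; apply: none; exists x.
- apply: Rnot_lt_le => /Rlt_le/(lower n t hn1)[x lt_x].
  by have := t_mixed x; lra.
have le_t : INR t <= INR (A * tau n).
  apply/le_INR/leP; rewrite leqNgt; apply/negP => /t_min; apply.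
  by move=> x; apply: upper.
apply: Rle_trans le_t _; rewrite mult_INR.
have nR : 3 <= INR n by have := le_INR 3 n (leP n3); rewrite /=; lra.
have [_ tau_le] := tau_bounds (ltnW (ltnW n3)).
have ln1 : 1 <= ln (INR n).
  have <- : ln (exp 1) = 1 by rewrite ln_exp.
  have := exp_le_3; have := exp_pos 1 => e0 e3.
  have le : exp 1 <= INR n by lra.
  by case: le => [lt|->]; [apply/Rlt_le/ln_increasing | apply: Rle_refl].
have n9 : 9 <= INR n ^ 2 by nra.
have big : 1 <= INR n ^ 2 * ln (INR n) by nra.
have A0 := pos_INR A.
rewrite Rmult_assoc; move: (INR n ^ 2 * _) big tau_le => z z1 tau_le.
have : INR A * INR (tau n) <= INR A * (2 * z) by apply: Rmult_le_compat_l; lra.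
by nra.
Qed.
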